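(* Let $\Sigma$ be a smoothly embedded $2$-sphere in a complete Riemannian manifold $(M^n,g)$ (the case in which $M$ is itself a $2$-sphere and $\Sigma=M$ is allowed), and let $\{x,y\}\in\mathcal{P}_\Sigma$. If there exists a set $\{\gamma_1,\ldots,\gamma_k\}$ of simultaneously stationary geodesics with endpoints $x$ and $y$, then $\{x,y\}$ is a critical point of the distance function. Conversely, if $\{x,y\}$ is a critical point of the distance function, then there exist an integer $k\le 5$ and a set of $k$ simultaneously stationary minimizing geodesics with endpoints $x$ and $y$.
   Context: $\mathcal{P}_\Sigma=\{\{p,q\}: p,q\in\Sigma\}$ is the set of subsets of $\Sigma$ with one or two points ($p=q$ is admissible). The distance function is the one induced by $g$ on $M$, evaluated on pairs in $\mathcal{P}_\Sigma$. A minimizing geodesic is a geodesic of $(M,g)$ realizing the distance between its endpoints. For a minimizing geodesic $\gamma:[0,a]\to M$ parametrized by arc-length with $\gamma(0)=x$ and $\gamma(a)=y$, put $\nu_\gamma=(-\gamma'(0),\gamma'(a))\in T_xM\times T_yM$ (the outward pointing unit tangent vectors of $\gamma$ at its endpoints), and let $\nu_\gamma^T=(-\gamma'(0)^T,\gamma'(a)^T)\in T_x\Sigma\times T_y\Sigma$ be given by the orthogonal projections of these vectors on $T\Sigma$. On $T_xM\times T_yM$ use the inner product $g((w_1,w_2),(v_1,v_2))=g(w_1,v_1)+g(w_2,v_2)$. Regular and critical points: $\{x,y\}\in\mathcal{P}_\Sigma$ is a regular point of the distance function if there exists $(w_1,w_2)\in T_x\Sigma\times T_y\Sigma$ such that,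 whenever $\gamma:[0,a]\to M$ is a minimizing geodesic parametrized by arc-length with $\gamma(0)=x$ and $\gamma(a)=y$, one has $g((w_1,w_2),\nu_\gamma)=g(w_2,\gamma'(a))-g(w_1,\gamma'(0))<0$. A point $\{x,y\}\in\mathcal{P}_\Sigma$ is a critical point of the distance function if it is not a regular point. Simultaneously stationary: let $\{x,y\}\in\mathcal{P}_\Sigma$ and let $\gamma_1,\ldots,\gamma_k:[0,a]\to M$ be minimizing geodesics parametrized by arc-length with $\gamma_i(0)=x$ and $\gamma_i(a)=y$ for every $1\le i\le k$. The set $\{\gamma_1,\ldots,\gamma_k\}$ is called simultaneously stationary with endpoints $x$ and $y$ if there exist constants $0<c_i\le 1$, $1\le i\le k$, such that $\sum_{i=1}^k c_i=1$ and $\sum_{i=1}^k c_i\,\nu_{\gamma_i}^T$ is the zero vector in $T_x\Sigma\times T_y\Sigma$. The case $k=1$ is included; it corresponds to a minimizing geodesic joining $x$ and $y$ that is orthogonal to $\Sigma$ at both endpoints. *)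

(* Defs.v *)
From HB Require Import structures.
From mathcomp Require Import all_boot all_order all_algebra.
From mathcomp Require Import all_classical all_reals all_analysis.
Import Order.TTheory GRing.Theory Num.Theory.
Import numFieldNormedType.Exports.

Set Implicit Arguments.
Unset Strict Implicit.
Unset Printing Implicit Defensive.

Local Open Scope classical_set_scope.
Local Open Scope ring_scope.

(* [Ck k U f]: [f] is of class C^k on the open set [U].  A map is C^(k+1) on [U]
   iff it is differentiable there with all directional derivatives C^k. *)
Fixpoint Ck (R : realType) (V W : normedModType R) (k : nat) (U : set V)
    (f : V -> W) : Prop :=
  match k with
  | 0 => forall x, U x -> {for x, continuous f}
  | k'.+1 => (forall x, U x -> differentiable f x) /\
             (forall v, Ck k' U (fun x => 'D_v f x))
  end.

Definition smooth (R : realType) (V W : normedModType R) (U : set V)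
    (f : V -> W) : Prop := forall k, Ck k U f.

(* Smooth n-manifolds.  The chart of index [i] has domain [dom i], coordinates
   [phi i] and inverse [psi i]; [phi i] and [psi i] are total functions whose
   values outside [dom i] and [phi i @` dom i] are irrelevant.  [chart_at p] is a
   preferred chart around [p]: a tangent vector at [p] is represented by its
   components in that chart, so that every tangent space is ['rV[R]_n]. *)
Record manifold (R : realType) (n : nat) := Manifold {
  pt :> topologicalType;
  pt_hausdorff : hausdorff_space pt;
  pt_second_countable : @second_countable pt;
  chart : Type;
  dom : chart -> set pt;
  phi : chart -> pt -> 'rV[R]_n;
  psi : chart -> 'rV[R]_n -> pt;
  chart_at : pt -> chart;
  chart_at_dom : forall p, dom (chart_at p) p;
  dom_open : forall i, open (dom i);
  cod_open : forall i, open (phi i @` dom i);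
  phiK : forall i p, dom i p -> psi i (phi i p) = p;
  phi_continuous : forall i p, dom i p -> {for p, continuous (phi i)};
  psi_continuous : forall i u, (phi i @` dom i) u -> {for u, continuous (psi i)};
  transition_smooth : forall i j,
    smooth (phi i @` (dom i `&` dom j)) (phi j \o psi i)
}.

Section Manifold.
Context (R : realType) (n : nat) (M : manifold R n).

Definition smooth_map (V : normedModType R) (U : set V) (F : V -> M) : Prop :=
  (forall u, U u -> {for u, continuous F}) /\
  (forall i : chart M, smooth (U `&` F @^-1` dom i) (phi i \o F)).

Definition tangent_map (V : normedModType R) (F : V -> M) (u w : V) : 'rV[R]_n :=
  'D_w (phi (chart_at (F u)) \o F) u.

Definition velocity (c : R -> M) (t : R) : 'rV[R]_n := tangent_map c t (1 : R).

Definition coord_vector (i : chart M) (a : 'I_n) (u : 'rV[R]_n) : 'rV[R]_n :=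
  tangent_map (psi i) u (delta_mx 0 a).

End Manifold.

(* A Riemannian metric: [gram p] is the Gram matrix of the inner product of the
   tangent space at [p] in the components of the preferred chart.  Since that
   chart depends on [p], smoothness is a condition on the local expressions in
   each fixed chart. *)
Definition bilin (R : realType) (n : nat) (A : 'M[R]_n) (v w : 'rV[R]_n) : R :=
  (v *m A *m w^T) 0 0.

Record metric (R : realType) (n : nat) (M : manifold R n) := Metric {
  gram : M -> 'M[R]_n;
  gram_sym : forall p, (gram p)^T = gram p;
  gram_pos : forall p v, v != 0 -> 0 < bilin (gram p) v v;
  gram_smooth : forall (i : chart M) (a b : 'I_n),
    smooth (phi i @` dom i)
      (fun u => bilin (gram (psi i u)) (coord_vector i a u) (coord_vector i b u))
}.

Section Riemannian.
Context (R : realType) (n : nat) (M : manifold R n) (g : metric M).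

Definition inner (p : M) (v w : 'rV[R]_n) : R := bilin (gram g p) v w.

Definition speed (c : R -> M) (t : R) : R :=
  Num.sqrt (inner (c t) (velocity c t) (velocity c t)).

Definition arc_length (c : R -> M) (a b : R) : \bar R :=
  (\int[lebesgue_measure]_(t in `[a, b]) (speed c t)%:E)%E.

(* Smooth curves on a compact interval are those that extend smoothly to an open
   neighbourhood of it. *)
Definition smooth_arc (c : R -> M) (a b : R) : Prop :=
  exists2 J : set R, open J & `[a, b] `<=` J /\ smooth_map J c.

(* [joined p q l]: some piecewise smooth curve from [p] to [q] has length [l]. *)
Inductive joined (p : M) : M -> \bar R -> Prop :=
| joined_refl : joined p p 0%E
| joined_step q l (c : R -> M) (a b : R) :
    joined p q l -> a <= b -> smooth_arc c a b -> c a = q ->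
    joined p (c b) (l + arc_length c a b)%E.

(* The distance is +oo between distinct components of [M]. *)
Definition dist (p q : M) : \bar R := ereal_inf [set l | joined p q l].

Definition local_gram (i : chart M) (u : 'rV[R]_n) : 'M[R]_n :=
  \matrix_(a < n, b < n)
    inner (psi i u) (coord_vector i a u) (coord_vector i b u).

Definition christoffel (i : chart M) (u : 'rV[R]_n) (k a b : 'I_n) : R :=
  let dG c d e := 'D_(delta_mx 0 c) (fun u' => local_gram i u' d e) u in
  2^-1 * \sum_(l < n)
    invmx (local_gram i u) k l * (dG a b l + dG b a l - dG l a b).

Definition geodesic_on (J : set R) (c : R -> M) : Prop :=
  smooth_map J c /\
  forall (i : chart M) (t : R) (k : 'I_n), J t -> dom i (c t) ->
    let x := phi i \o c in
    (derive1 (derive1 x) t) 0 k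
      + \sum_(a < n) \sum_(b < n)
          christoffel i (x t) k a b * derive1 x t 0 a * derive1 x t 0 b = 0.

Definition complete_metric : Prop := forall (p : M) (v : 'rV[R]_n),
  exists c : R -> M, [/\ geodesic_on setT c, c 0 = p & velocity c 0 = v].

(* Minimizing geodesics from [x] to [y] parametrized by arc length on [0, a].
   The curve is a total function that is only relevant on [0, a]; as for
   [smooth_arc], it is a geodesic on a neighbourhood of that interval, so that
   the velocities at the endpoints are the one-sided ones. *)
Definition min_geodesic (x y : M) (a : R) (c : R -> M) : Prop :=
  [/\ 0 < a,
      exists2 J : set R, open J & `[0, a] `<=` J /\ geodesic_on J c,
      (forall t, t \in `[0, a] -> speed c t = 1),
      c 0 = x /\ c a = y
    & arc_length c 0 a = dist x y].

Definition inner2 (x y : M) (w v : 'rV[R]_n * 'rV[R]_n) : R :=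
  inner x w.1 v.1 + inner y w.2 v.2.

Definition nu (a : R) (c : R -> M) : 'rV[R]_n * 'rV[R]_n :=
  (- velocity c 0, velocity c a).

End Riemannian.

Definition unit_sphere (R : realType) : set 'rV[R]_3 :=
  [set u | (u *m u^T) 0 0 = 1].
Arguments unit_sphere : clear implicits.

(* A smooth embedding of the unit sphere of R^3, given by a smooth extension to a
   neighbourhood [U] of the sphere (e.g. the radial extension): an injective
   immersion that is a homeomorphism onto its image. *)
Definition sphere_embedding (R : realType) (n : nat) (M : manifold R n)
    (f : 'rV[R]_3 -> M) : Prop :=
  let S := unit_sphere R in
  [/\ exists2 U : set 'rV[R]_3, open U & S `<=` U /\ smooth_map U f,
      (forall u w, S u -> (u *m w^T) 0 0 = 0 ->
         tangent_map f u w = 0 -> w = 0),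
      (forall u v, S u -> S v -> f u = f v -> u = v)
    & (forall V : set 'rV[R]_3, open V ->
         exists2 W : set M, open W & f @` (S `&` V) = W `&` f @` S)].

(* Embedded 2-spheres in [M]; [sph] is the underlying subset. *)
Record embedded_sphere (R : realType) (n : nat) (M : manifold R n) :=
  EmbeddedSphere {
    sph_map : 'rV[R]_3 -> M;
    sph_embedding : sphere_embedding sph_map
  }.

Section Sphere.
Context (R : realType) (n : nat) (M : manifold R n) (g : metric M).
Context (Sigma : embedded_sphere M).

Definition sph : set M := sph_map Sigma @` unit_sphere R.

Definition tangent_space (x : M) : set 'rV[R]_n :=
  [set v | exists u w, [/\ unit_sphere R u, sph_map Sigma u = x,
                           (u *m w^T) 0 0 = 0
                         & v = tangent_map (sph_map Sigma) u w]].

Definition pairs : set (set M) :=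
  [set A | exists p q, [/\ sph p, sph q & A = [set p; q]]].

Definition tangent_proj (x : M) (v : 'rV[R]_n) : 'rV[R]_n :=
  xget 0 [set w | tangent_space x w /\
                  forall z, tangent_space x z -> inner g x (v - w) z = 0].

Definition nuT (x y : M) (a : R) (c : R -> M) : 'rV[R]_n * 'rV[R]_n :=
  (tangent_proj x (nu a c).1, tangent_proj y (nu a c).2).

Definition regular_point (x y : M) : Prop :=
  exists w : 'rV[R]_n * 'rV[R]_n,
    [/\ tangent_space x w.1, tangent_space y w.2
      & forall a c, min_geodesic g x y a c -> inner2 g x y w (nu a c) < 0].

Definition critical_point (x y : M) : Prop := ~ regular_point x y.

(* The set {gamma_1, ..., gamma_k} is given as a family of curves that are
   pairwise distinct on [0, a]. *)
Definition simultaneously_stationary (x y : M) (a : R) (k : nat)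
    (gamma : 'I_k -> R -> M) : Prop :=
  [/\ forall i, min_geodesic g x y a (gamma i),
      forall i j, i != j -> exists2 t, t \in `[0, a] & gamma i t <> gamma j t
    & exists c : 'I_k -> R,
        [/\ forall i, 0 < c i <= 1, \sum_(i < k) c i = 1
          & \sum_(i < k) c i *: nuT x y a (gamma i) = 0]].

End Sphere.

(* Main.v *)
Require Import Defs.
From mathcomp Require Import all_boot all_order all_algebra.
From mathcomp Require Import all_classical all_reals all_analysis.
From mathcomp Require Import ring lra.
Import Order.TTheory GRing.Theory Num.Theory.
Import numFieldNormedType.Exports.
Local Open Scope classical_set_scope.
Local Open Scope ring_scope.

Set Implicit Arguments.
Unset Strict Implicit.
Unset Printing Implicit Defensive.

(** Both directions concern the set K of outward vectors [nu a c] of the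
    minimizing geodesics from [x] to [y], paired with the vectors of
    T_x Sigma x T_y Sigma, a Euclidean space of dimension at most 4. Only the
    tangential parts matter for this pairing, so that a regular point is one for
    which the tangential part of K lies in an open half-space bounded by a
    hyperplane through the origin, and simultaneous stationarity says that the
    origin is a convex combination of elements of that part. A convex
    combination of elements of an open half-space stays in it, which is the
    first implication ([stationary_critical]).

    For the converse ([critical_stationary]), the tangential part of K is
    compact. The point of its convex hull nearest to the origin then exists; if
    it were not the origin, its opposite would define a half-space containing
    the tangential part of K. By Caratheodory's theorem, 4 + 1 = 5 points of K
    suffice to write the origin as a convex combination
    ([convex_alternative]). The linear independence used to reduce the number of
    points also makes them pairwise distinct, hence so are the geodesics.

    The geometric content is the compactness of K
    ([endpoint_velocities_compact]). All minimizing geodesics from [x] to [y]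
    have the same length [a], the distance, and start with a unit vector, so
    that their initial velocities subconverge; completeness provides the
    geodesic [c] with the limit velocity. Geodesics solve an ordinary
    differential equation with locally Lipschitz coefficients in each chart, so
    that the given geodesics converge to [c] with their velocities, uniformly in
    charts and hence, chart after chart, along all of [0, a]
    ([local_dependence], [converges_everywhere]). Therefore [c] ends at [y], has
    unit speed and length [a], and is again minimizing ([min_geodesic_limit]). *)

(** * Convex combinations *)

(** When the rows with nonzero coefficients are dependent, subtracting from [c]
    the largest multiple of the relation that keeps all coefficients nonnegative
    makes one of them vanish; the support shrinks until its rows are
    independent. *)
Lemma caratheodory_cone (R : realFieldType) (m D : nat) (Z : 'M[R]_(m, D))
    (c : 'rV[R]_m) :
  (forall i, 0 <= c 0 i) ->
  exists c' : 'rV[R]_m,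
    [/\ forall i, 0 <= c' 0 i,
        c' *m Z = c *m Z
      & forall mu : 'rV[R]_m, (forall i, c' 0 i = 0 -> mu 0 i = 0) ->
          mu *m Z = 0 -> mu = 0].
Proof.
have [s] := ubnP #|[pred i | c 0 i != 0]|.
elim: s c => // s IH c; rewrite ltnS => sle c0.
have [//|nfree] := pselect (forall mu : 'rV[R]_m,
  (forall i, c 0 i = 0 -> mu 0 i = 0) -> mu *m Z = 0 -> mu = 0).
  by exists c.
have [mu [muc muZ [i0 mui0]]] : exists mu : 'rV[R]_m,
    [/\ (forall i, c 0 i = 0 -> mu 0 i = 0), mu *m Z = 0
      & exists i, 0 < mu 0 i].
  move: nfree => /existsNP[mu /not_implyP[muc /not_implyP[muZ /eqP/rV0Pn[i mui]]]].
  have [mu0|mu0|/eqP] := ltgtP (mu 0 i) 0; last by rewrite (negbTE mui).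
  - exists (- mu); split.
    + by move=> j /muc; rewrite mxE => ->; rewrite oppr0.
    + by rewrite mulNmx muZ oppr0.
    + by exists i; rewrite mxE oppr_gt0.
  - by exists mu; split => //; exists i.
(* the step length at which the first positive coefficient vanishes *)
pose t i := c 0 i / mu 0 i.
case: (Order.TotalTheory.arg_minP (P := fun i => 0 < mu 0 i) t mui0) => i1 /= mui1 tmin.
have t_ge0 : 0 <= t i1 by rewrite divr_ge0// ltW.
pose c1 := c - t i1 *: mu.
have [||c' [c'0 c'Z c'free]] := IH c1.
- apply: leq_trans sle; apply: proper_card; apply/properP; split.
    apply/fintype.subsetP => i; rewrite !inE; apply: contraNN => /eqP ci.
    by rewrite !mxE ci muc// mulr0 subr0.
  exists i1; rewrite !inE.
    apply/eqP => /muc mu1; by rewrite mu1 ltxx in mui1.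
  by rewrite !mxE /t divfK ?subrr ?eqxx ?gt_eqF.
- move=> i; rewrite !mxE subr_ge0.
  have [mui|mui] := ltP 0 (mu 0 i).
    by rewrite -ler_pdivlMr// tmin.
  by rewrite (le_trans _ (c0 i))// mulr_ge0_le0.
exists c'; split=> //; rewrite c'Z /c1 mulmxBl -scalemxAl muZ scaler0 subr0 //.
Qed.

(** Appending a coordinate 1 to the points turns convex combinations into conic
    ones. Independent rows of length [d + 1] are at most [d + 1] in number, and
    they are pairwise distinct. *)
Lemma caratheodory (R : realFieldType) (d m : nat) (c : 'rV[R]_m)
    (X : 'I_m -> 'rV[R]_d) :
  (forall i, 0 <= c 0 i) -> \sum_i c 0 i = 1 ->
  exists (k : nat) (e : 'I_k -> 'I_m) (c' : 'rV[R]_k),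
    [/\ (k <= d.+1)%N, injective (X \o e), forall i, 0 < c' 0 i,
        \sum_i c' 0 i = 1
      & \sum_i c' 0 i *: X (e i) = \sum_i c 0 i *: X i].
Proof.
move=> c0 c1.
pose Z : 'M[R]_(m, 1 + d) := \matrix_i row_mx 1 (X i).
have mulZ (b : 'rV[R]_m) :
    b *m Z = row_mx (const_mx (\sum_i b 0 i)) (\sum_i b 0 i *: X i).
  rewrite mulmx_sum_row; apply/rowP => j; rewrite summxE.
  rewrite -[j]splitK; case: (fintype.split j) => j' /=.
    rewrite row_mxEl mxE; apply: eq_bigr => i _.
    by rewrite rowK mxE row_mxEl ord1 mxE eqxx mulr1.
  rewrite row_mxEr summxE; apply: eq_bigr => i _.
  by rewrite rowK mxE row_mxEr mxE.
have [c' [c'0 c'Z c'free]] := caratheodory_cone Z c0.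
move: (c'Z); rewrite !mulZ => /eq_row_mx[/rowP/(_ 0)].
rewrite !mxE c1 => c'1 c'X.
pose S := [pred i | c' 0 i != 0].
pose e : 'I_#|S| -> 'I_m := enum_val.
have outS i : i \notin S -> c' 0 i = 0 by rewrite inE negbK => /eqP.
have sumS (V : lmodType R) (F : 'I_m -> V) :
    \sum_i c' 0 (e i) *: F (e i) = \sum_i c' 0 i *: F i.
  rewrite -(@big_enum_val _ _ _ _ S (fun i => c' 0 i *: F i)) [RHS](bigID (mem S)) /=.
  rewrite [X in _ = _ + X]big1 ?addr0// => i /outS ->; by rewrite scale0r.
(* a relation between the selected rows is a relation between all rows
   supported on the selection *)
have rel (mu : 'rV[R]_#|S|) : mu *m rowsub e Z = 0 -> mu = 0.
  move=> muZ.
  have -> : mu = colsub e (mu *m rowsub e 1%:M).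
    apply/rowP => j; rewrite !mxE (bigD1 j)//= big1 ?addr0.
      by rewrite !mxE eqxx mulr1.
    by move=> i ij; rewrite !mxE (inj_eq enum_val_inj) (negbTE ij) mulr0.
  rewrite (c'free (mu *m rowsub e 1%:M)) ?linear0//; last first.
    by rewrite -mulmxA mul_rowsub_mx mul1mx.
  move=> i ci; rewrite mxE big1// => j _; rewrite !mxE.
  have [ji|] := eqVneq (e j) i; last by rewrite mulr0.
  by have := enum_valP j; rewrite -/(e j) ji inE ci eqxx.
exists #|S|, e, (colsub e c'); split.
- have : row_free (rowsub e Z) by apply: inj_row_free => v; exact: rel.
  by rewrite /row_free => /eqP <-; exact: rank_leq_col.
- move=> i j /= Xij; apply/eqP/negPn/negP => ij.
  have muZ : (delta_mx 0 i - delta_mx 0 j : 'rV_#|S|) *m rowsub e Z = 0.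
    by rewrite mulmxBl -!rowE !row_rowsub !rowK Xij subrr.
  by have /rowP/(_ i)/eqP := rel _ muZ; rewrite !mxE !eqxx/= (negbTE ij) subr0 oner_eq0.
- move=> i; rewrite mxE lt_neqAle c'0 andbT eq_sym.
  by have := enum_valP i; rewrite inE.
- transitivity (\sum_i c' 0 (e i) *: (1 : R^o)).
    by apply: eq_bigr => i _; rewrite mxE [RHS]mulr1.
  by rewrite (sumS R^o (fun=> 1)) -[RHS]c'1; apply: eq_bigr => i _; exact: mulr1.
- rewrite -c'X -sumS; apply: eq_bigr => i _; by rewrite mxE.
Qed.

Lemma compact_row (T : ptopologicalType) m (K : set T) :
  compact K -> compact [set v : 'rV[T]_m | forall i, K (v 0 i)].
Proof. by move=> Kc; apply: (@rV_compact _ _ (fun=> K)). Qed.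

Lemma cvg_sumr (R : numFieldType) (V : normedModType R) (T : Type)
    (F : set_system T) {FF : Filter F} m (f : 'I_m -> T -> V) (a : 'I_m -> V) :
  (forall i, f i t @[t --> F] --> a i) ->
  \sum_i f i t @[t --> F] --> \sum_i a i.
Proof. by move=> fa; apply: cvg_big => //; exact: add_continuous. Qed.

Lemma continuous_sumr (R : numFieldType) (V : normedModType R)
    (T : topologicalType) m (f : 'I_m -> T -> V) (x : T) :
  (forall i, {for x, continuous (f i)}) ->
  {for x, continuous (fun t => \sum_i f i t)}.
Proof. by move=> fx; apply: (@cvg_sumr _ _ _ (nbhs x)) => i; exact: fx. Qed.

Lemma simplex_compact (R : realType) m :
  compact [set c : 'rV[R]_m | (forall i, 0 <= c 0 i) /\ \sum_i c 0 i = 1].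
Proof.
rewrite (_ : mkset _ = [set c : 'rV[R]_m | forall i, `[0, 1]%classic (c 0 i)]
    `&` [set c : 'rV[R]_m | \sum_i c 0 i = 1]).
  apply: compact_closedI.
    by apply: compact_row; exact: segment_compact.
  apply: (@preimage_closed _ _ (fun c : 'rV[R]_m => \sum_i c 0 i) [set 1]).
    by move=> c _; apply: continuous_sumr => i; exact: coord_continuous.
  exact: closed_eq.
apply/seteqP; split => c /= [c0 c1]; split=> // i.
  rewrite in_itv /= c0 /= -c1 (bigD1 i)//= lerDl sumr_ge0//.
by have := c0 i; rewrite in_itv/= => /andP[].
Qed.

Lemma row_entry_continuous (T : topologicalType) m (i : 'I_m) :
  continuous (fun X : 'rV[T]_m => X 0 i).
Proof.
move=> X A /= XA; exists (fun k j => if j == i then A else setT).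
  by move=> k j; case: eqP => [->|_]; [rewrite ord1|exact: filterT].
by move=> Y /(_ 0 i); rewrite eqxx.
Qed.

(** A separation theorem: if the origin is not in the convex hull, let [p] be
    the point nearest to it among the combinations of [d + 1] points of [K]. By
    Caratheodory's theorem [p] is nearest among all convex combinations, so that
    moving from [p] towards a point [v] of [K] does not decrease the norm; to
    first order this gives [p . v >= p . p > 0], against the hypothesis for
    [w = - p]. *)
Lemma convex_alternative (R : realType) (d : nat) (K : set 'rV[R]_d) :
  compact K -> K !=set0 ->
  (forall w : 'rV[R]_d, exists2 v, K v & 0 <= (w *m v^T) 0 0) ->
  exists (k : nat) (X : 'I_k -> 'rV[R]_d) (c : 'I_k -> R),
    [/\ (k <= d.+1)%N, injective X /\ (forall i, K (X i)), forall i, 0 < c i,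
        \sum_i c i = 1 & \sum_i c i *: X i = 0].
Proof.
move=> Kc [v0 Kv0] Kw.
pose Q (q : 'rV[R]_d) : R := \sum_j q 0 j ^+ 2.
pose comb (z : 'rV[R]_d.+1 * 'rV['rV[R]_d]_d.+1) :=
  \sum_i z.1 0 i *: z.2 0 i.
pose A := [set c : 'rV[R]_d.+1 | (forall i, 0 <= c 0 i) /\ \sum_i c 0 i = 1]
  `*` [set X : 'rV['rV[R]_d]_d.+1 | forall i, K (X 0 i)].
have Ac : compact A by apply: compact_setX; [exact: simplex_compact|exact: compact_row].
have comb_cont : continuous comb.
  move=> z; apply: continuous_sumr => i; apply: cvgZ.
    apply: (@continuous_comp _ _ _ fst (fun c : 'rV[R]_d.+1 => c 0 i)).
      exact: cvg_fst.
    exact: coord_continuous.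
  apply: (@continuous_comp _ _ _ snd (fun X : 'rV['rV[R]_d]_d.+1 => X 0 i)).
    exact: cvg_snd.
  exact: row_entry_continuous.
have Q_cont : continuous Q.
  move=> q; apply: continuous_sumr => j.
  apply: (@continuous_comp _ _ _ (fun q : 'rV[R]_d => q 0 j) (fun x => x ^+ 2)).
    exact: coord_continuous.
  exact: exprn_continuous.
have A0 : A !=set0.
  exists (delta_mx 0 0, const_mx v0); split; last by move=> i; rewrite mxE.
  split; first by move=> i; rewrite mxE ler0n.
  rewrite (bigD1 0)//= big1 ?addr0 ?mxE ?eqxx// => i i0.
  by rewrite mxE (negbTE i0) andbF.
have [z /set_mem zA zmin] : exists2 z, z \in A &
    forall t, t \in A -> Q (comb z) <= Q (comb t).
  apply: (@compact_EVT_min _ _ (Q \o comb)) => //.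
  by apply: continuous_subspaceT => t; apply: continuous_comp;
    [exact: comb_cont|exact: Q_cont].
set p := comb z in zmin.
have pmin m (c : 'rV[R]_m) (X : 'I_m -> 'rV[R]_d) :
    (forall i, 0 <= c 0 i) -> \sum_i c 0 i = 1 -> (forall i, K (X i)) ->
    Q p <= Q (\sum_i c 0 i *: X i).
  move=> c0 c1 KX.
  have [k [e [c' [kd _ c'0 c'1 <-]]]] := caratheodory X c0 c1.
  (* pad to exactly [d+1] points with zero weights *)
  pose c2 : 'rV[R]_d.+1 := \row_i oapp (c' 0) 0 (insub (i : nat)).
  pose X2 : 'rV['rV[R]_d]_d.+1 := \row_i oapp (X \o e) v0 (insub (i : nat)).
  have sum2 (V : nmodType) (F : option 'I_k -> V) : F None = 0 ->
      \sum_(i < d.+1) F (insub (i : nat)) = \sum_(i < k) F (Some i).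
    move=> F0; rewrite [RHS](eq_bigr (fun i : 'I_k => F (insub (i : nat)))); last first.
      by move=> i _; rewrite valK.
    rewrite (big_ord_widen _ (fun i => F (insub i)) kd) [RHS]big_mkcond /=.
    by apply: eq_bigr => i _; case: ltnP => // ki; rewrite insubN// -leqNgt.
  have -> : \sum_i c' 0 i *: X (e i) = comb (c2, X2).
    rewrite /comb /=; under [RHS]eq_bigr do rewrite !mxE.
    by rewrite (sum2 _ (fun o => oapp (c' 0) 0 o *: oapp (X \o e) v0 o))//= scale0r.
  apply: zmin; rewrite inE; split; last first.
    by move=> i; rewrite mxE; case: insubP => [j _ _|_] //=.
  split; first by move=> i; rewrite mxE; case: insubP => [j _ _|_] //=; exact: ltW.
  by under eq_bigr do rewrite mxE; rewrite (sum2 _ (oapp (c' 0) 0)).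
have [p0|pN0] := eqVneq p 0.
  have [k [e [c' [kd Xinj c'0 c'1 c'X]]]] := caratheodory (z.2 0) zA.1.1 zA.1.2.
  exists k, (z.2 0 \o e), (c' 0); split=> //; last by rewrite c'X.
  by split=> // i; exact: zA.2.
have Qp : 0 < Q p.
  rewrite lt_neqAle sumr_ge0 ?andbT; last by move=> i _; rewrite sqr_ge0.
  rewrite eq_sym; apply: contraNN pN0 => /eqP/psumr_eq0P Q0.
  apply/eqP/rowP => j; rewrite mxE; apply/eqP.
  by rewrite -sqrf_eq0 Q0// => i _; rewrite sqr_ge0.
have [v Kv] := Kw (- p).
rewrite mulNmx mxE oppr_ge0 leNgt => /negP[].
apply: lt_le_trans Qp _.
pose pv := \sum_j p 0 j * v 0 j.
have -> : (p *m v^T) 0 0 = pv by rewrite mxE; apply: eq_bigr => j _; rewrite mxE.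
have step t : 0 <= t <= 1 -> Q p <= Q ((1 - t) *: p + t *: v).
  move=> /andP[t0 t1].
  have -> : (1 - t) *: p + t *: v = \sum_(i < d.+2)
      (\row_i oapp (fun j => (1 - t) * z.1 0 j) t (unlift 0 i)) 0 i *:
      oapp (z.2 0) v (unlift 0 i).
    rewrite big_ord_recl mxE unlift_none /= addrC; congr (_ + _).
    rewrite scaler_sumr; apply: eq_bigr => i _.
    by rewrite mxE liftK /= scalerA.
  apply: pmin.
  - move=> i; rewrite mxE; case: unliftP => [j _|_] //=.
    by rewrite mulr_ge0 ?subr_ge0//; exact: zA.1.1.
  - rewrite big_ord_recl mxE unlift_none /=.
    under eq_bigr do rewrite mxE liftK /=.
    by rewrite -mulr_sumr zA.1.2 mulr1 addrC subrK.
  - by move=> i; case: unliftP => [j _|_] //=; exact: zA.2.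
have Qstep t : Q ((1 - t) *: p + t *: v) =
    Q p + t * (2 * (pv - Q p)) + t ^+ 2 * Q (v - p).
  rewrite /Q /pv -sumrB !mulr_sumr -!big_split /=.
  by apply: eq_bigr => j _; rewrite !mxE; ring.
rewrite leNgt; apply/negP => pvlt.
have D0 : 0 < Q p - pv by rewrite subr_gt0.
have V0 : 0 <= Q (v - p) by apply: sumr_ge0 => i _; rewrite sqr_ge0.
(* small enough for the linear term to dominate the quadratic one *)
pose t := (Q p - pv) / (Q p - pv + Q (v - p)).
have den : 0 < Q p - pv + Q (v - p) by rewrite ltr_wpDr.
have t0 : 0 < t by rewrite divr_gt0.
have t1 : t <= 1 by rewrite ler_pdivrMr// mul1r lerDl.
have tQ : t * Q (v - p) <= Q p - pv.
  by rewrite /t mulrAC ler_pdivrMr// ler_pM2l// lerDr ltW.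
have := step t; rewrite t1 ltW// => /(_ isT); rewrite Qstep.
nra.
Qed.

(** * Lipschitz maps and ordinary differential equations *)

(** Continuity arguments along an interval are phrased with this principle: it
    serves both to keep a curve inside a chart and to propagate convergence from
    chart to chart. *)
Lemma real_induction (R : realType) (a b : R) (P : R -> Prop) :
  P a ->
  (forall x, a <= x < b -> (forall y, a <= y <= x -> P y) ->
     exists2 e, 0 < e & forall y, x < y < x + e -> y <= b -> P y) ->
  (forall x, a < x <= b -> (forall y, a <= y < x -> P y) -> P x) ->
  forall x, a <= x <= b -> P x.
Proof.
move=> Pa step limit x /andP[ax xb].
have ab := le_trans ax xb.
pose S := [set u | a <= u <= b /\ forall y, a <= y <= u -> P y].
have Sa : S a.
  split; first by rewrite lexx.
  by move=> y /andP[ya ay]; rewrite (@le_anti _ _ y a) ?ya ?ay.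
have Sub : ubound S b by move=> u [/andP[]].
have supS : has_sup S by split; [exists a|exists b].
set s := sup S.
have as_ : a <= s by apply: sup_ubound => //; exists b.
have sb : s <= b by apply: ge_sup => //; exists a.
have Plt y : a <= y < s -> P y.
  move=> /andP[ay ys].
  have sy : 0 < s - y by rewrite subr_gt0.
  have [u [_ uP] yu] := sup_adherent sy supS.
  by apply: uP; rewrite ay ltW//; move: yu; rewrite subKr.
have Ps : P s.
  have [<-//|] := eqVneq a s; rewrite neq_lt => /orP[sa|]; last by rewrite ltNge as_.
  by apply: limit; rewrite ?sa.
have Ple y : a <= y <= s -> P y.
  by move=> /andP[ay]; rewrite le_eqVlt => /predU1P[->//|ys]; apply: Plt; rewrite ay.
suff bs : b <= s by apply: Ple; rewrite ax (le_trans xb).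
rewrite leNgt; apply/negP => slt.
have [|e e0 eP] := step s _ Ple; first by rewrite as_.
pose u := Num.min b (s + e / 2).
have su : s < u by rewrite lt_min slt ltrDl divr_gt0.
have : S u.
  split; first by rewrite (le_trans as_ (ltW su)) ge_min lexx.
  move=> y /andP[ay yu]; have [ys|sy] := leP y s; first by apply: Ple; rewrite ay.
  apply: eP; last by rewrite (le_trans yu)// ge_min lexx.
  rewrite sy /= (le_lt_trans yu)// gt_min; apply/orP; right.
  by rewrite ltrD2l ltr_pdivrMr// ltr_pMr// ltr1n.
by move/(sup_ubound (ex_intro _ _ Sub)); rewrite leNgt su.
Qed.

Section RowNorm.
Context (R : realType) (n : nat).

Lemma norm_coord (v : 'rV[R]_n) i : `|v 0 i| <= `|v|.
Proof.
rewrite [leRHS]/Num.Def.normr/= mx_normrE.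
exact: (le_bigmax _ (fun ij => `|v ij.1 ij.2|) (0, i)).
Qed.

Lemma norm_row_le (v : 'rV[R]_n) C :
  0 <= C -> (forall i, `|v 0 i| <= C) -> `|v| <= C.
Proof.
move=> C0 vC; rewrite [leLHS]/Num.Def.normr/= mx_normrE.
apply: bigmax_le => // -[i j] _.
by rewrite ord1.
Qed.

Lemma cvg_row (T : Type) (F : set_system T) {FF : Filter F}
    (f : T -> 'rV[R]_n) (l : 'rV[R]_n) :
  (forall i, f t 0 i @[t --> F] --> l 0 i) -> f @ F --> l.
Proof.
move=> fl; apply/cvgrPdist_le => e e0; near=> t.
apply: norm_row_le => [|i]; first exact: ltW.
rewrite !mxE; move: i; near: t; apply: filter_forall => i.
by move/cvgrPdist_le : (fl i) => /(_ _ e0).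
Unshelve. all: by end_near. Qed.

Lemma cvg_row_coord (T : Type) (F : set_system T) {FF : Filter F}
    (f : T -> 'rV[R]_n) (l : 'rV[R]_n) i :
  f @ F --> l -> f t 0 i @[t --> F] --> l 0 i.
Proof.
move=> fl.
exact: (@continuous_cvg _ _ _ F FF f (fun v => v 0 i) l
  (@coord_continuous _ _ _ 0 i l) fl).
Qed.

End RowNorm.

Section Derivatives.
Context (R : realType).

Lemma is_derive_line (V : normedModType R) (v z : V) (t : R) :
  is_derive t 1 (fun u : R => u *: v + z) v.
Proof.
have lim : h^-1 *: (((fun u : R => u *: v + z) \o shift t) (h *: 1) - (t *: v + z))
    @[h --> 0^'] --> v.
  apply: cvg_near_cst; near=> h => /=.
  have h0 : h != 0 by near: h; exact: nbhs_dnbhs_neq.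
  rewrite [h *: 1]mulr1 opprD addrACA subrr addr0 -scalerBl addrK scalerA.
  by rewrite mulVf// scale1r.
by apply: DeriveDef; [apply/cvg_ex; exists v|exact: cvg_lim lim].
Unshelve. all: by end_near. Qed.

Lemma derive_comp (U V W : normedModType R) (f : V -> W) (g : U -> V) x v :
  differentiable g x -> differentiable f (g x) ->
  'D_v (f \o g) x = 'D_('D_v g x) f (g x).
Proof.
move=> dg df; rewrite deriveE; last exact: differentiable_comp.
by rewrite diff_comp//= -deriveE// -deriveE.
Qed.

Lemma derive_sum_dir (n : nat) (V : normedModType R) (f : 'rV[R]_n -> V) x v :
  differentiable f x ->
  'D_v f x = \sum_(i < n) v 0 i *: 'D_(delta_mx 0 i) f x.
Proof.
move=> df; rewrite deriveE// {1}(row_sum_delta v) linear_sum.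
by apply: eq_bigr => i _; rewrite linearZ/= -deriveE.
Qed.

Lemma derive_coord (n : nat) (V : normedModType R) (f : V -> 'rV[R]_n) x v i :
  derivable f x v -> ('D_v f x) 0 i = 'D_v (fun y => f y 0 i) x.
Proof. by move=> df; rewrite derive_mx// mxE. Qed.

End Derivatives.

Definition locally_lipschitz (R : realType) (V W : normedModType R)
    (f : V -> W) (x : V) : Prop :=
  exists (L : R) (A : set V), [/\ 0 <= L, nbhs x A &
    forall y z, A y -> A z -> `|f y - f z| <= L * `|y - z|].

Section LocallyLipschitz.
Context (R : realType) (V : normedModType R).
Implicit Types (f g : V -> R) (x : V).

Lemma locally_lipschitz_continuous f x :
  locally_lipschitz f x -> {for x, continuous f}.
Proof.
move=> [L [A [L0 Ax fL]]]; apply/cvgrPdist_le => e e0.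
near=> y.
have : `|f x - f y| <= L * `|x - y|.
  apply: fL; first exact: nbhs_singleton.
  by near: y.
move/le_trans; apply.
have : `|x - y| <= e / (L + 1).
  near: y; apply: cvgr_dist_le; first exact: cvg_id.
  by rewrite divr_gt0// ltr_wpDl.
rewrite ler_pdivlMr ?ltr_wpDl// => h; apply: le_trans h.
by rewrite mulrC ler_wpM2l// lerDl.
Unshelve. all: by end_near. Qed.

Lemma near_locally_lipschitz f g x :
  (\near x, f x = g x) -> locally_lipschitz f x -> locally_lipschitz g x.
Proof.
move=> fg [L [A [L0 Ax fL]]].
exists L, (A `&` [set y | f y = g y]); split=> //; first exact: filterI.
by move=> y z [Ay <-] [Az <-]; exact: fL.
Qed.

Lemma locally_lipschitz_cst (a : R) x : locally_lipschitz (fun=> a : R) x.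
Proof.
exists 0, setT; split=> //; first exact: filterT.
by move=> y z _ _; rewrite subrr normr0 mul0r.
Qed.

Lemma locally_lipschitzD f g x :
  locally_lipschitz f x -> locally_lipschitz g x ->
  locally_lipschitz (fun y => f y + g y) x.
Proof.
move=> [L [A [L0 Ax fL]]] [K [B [K0 Bx gK]]].
exists (L + K), (A `&` B); split; [exact: addr_ge0|exact: filterI|].
move=> y z [Ay By] [Az Bz]; rewrite opprD addrACA mulrDl.
by apply: le_trans (ler_normD _ _) _; apply: lerD; [exact: fL|exact: gK].
Qed.

Lemma locally_lipschitzM f g x :
  locally_lipschitz f x -> locally_lipschitz g x ->
  locally_lipschitz (fun y => f y * g y) x.
Proof.
move=> fx gx; have fc := locally_lipschitz_continuous fx.
have gc := locally_lipschitz_continuous gx.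
move: fx gx => [L [A [L0 Ax fL]]] [K [B [K0 Bx gK]]].
have fb : \forall y \near x, `|f y| <= `|f x| + 1.
  by apply: cvgr_norm_le; [exact: fc|rewrite ltrDl].
have gb : \forall y \near x, `|g y| <= `|g x| + 1.
  by apply: cvgr_norm_le; [exact: gc|rewrite ltrDl].
exists (L * (`|g x| + 1) + (`|f x| + 1) * K), ((A `&` B) `&`
  ([set y | `|f y| <= `|f x| + 1] `&` [set y | `|g y| <= `|g x| + 1])); split.
- by rewrite addr_ge0// mulr_ge0// addr_ge0.
- by apply: filterI; apply: filterI.
move=> y z [[Ay By] [/= fy _]] [[Az Bz] [/= _ gz]].
have -> : f y * g y - f z * g z = (f y - f z) * g z + f y * (g y - g z) by ring.
apply: le_trans (ler_normD _ _) _; rewrite !normrM mulrDl; apply: lerD.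
  by rewrite mulrAC; apply: ler_pM => //; exact: fL.
by rewrite -mulrA; apply: ler_pM => //; exact: gK.
Qed.

Lemma locally_lipschitzV f x :
  f x != 0 -> locally_lipschitz f x -> locally_lipschitz (fun y => (f y)^-1) x.
Proof.
move=> fx0 fx; have fc := locally_lipschitz_continuous fx.
move: fx => [L [A [L0 Ax fL]]].
have e0 : 0 < `|f x| / 2 by rewrite divr_gt0// normr_gt0.
have fb : \forall y \near x, `|f x| / 2 < `|f y|.
  apply: cvgr_norm_gt; first exact: fc.
  by rewrite ltr_pdivrMr// ltr_pMr ?ltr1n// normr_gt0.
exists (L / (`|f x| / 2) ^+ 2), (A `&` [set y | `|f x| / 2 < `|f y|]); split.
- by rewrite divr_ge0// sqr_ge0.
- exact: filterI.
move=> y z [Ay /= fy] [Az /= fz].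
have fy0 : f y != 0 by rewrite -normr_gt0 (lt_trans e0).
have fz0 : f z != 0 by rewrite -normr_gt0 (lt_trans e0).
have -> : (f y)^-1 - (f z)^-1 = (f z - f y) / (f y * f z).
  by field; rewrite fy0 fz0.
rewrite normrM distrC normfV normrM mulrAC; apply: ler_pM => //.
  exact: fL.
rewrite expr2 lef_pV2 ?posrE ?mulr_gt0 ?normr_gt0//.
by apply: ler_pM; rewrite ltW.
Qed.

Lemma locally_lipschitz_sum (I : Type) (r : seq I) (P : pred I) (f : I -> V -> R) x :
  (forall i, locally_lipschitz (f i) x) ->
  locally_lipschitz (fun y => \sum_(i <- r | P i) f i y) x.
Proof.
move=> fx; elim: r => [|i r IH].
  rewrite (_ : (fun y => _) = fun=> 0); first exact: locally_lipschitz_cst.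
  by apply/funext => y; rewrite big_nil.
rewrite (_ : (fun y => _) = fun y => if P i then
    f i y + \sum_(j <- r | P j) f j y else \sum_(j <- r | P j) f j y).
  by case: (P i) => //; exact: locally_lipschitzD.
by apply/funext => y; rewrite big_cons.
Qed.

Lemma locally_lipschitz_prod (I : Type) (r : seq I) (P : pred I) (f : I -> V -> R) x :
  (forall i, locally_lipschitz (f i) x) ->
  locally_lipschitz (fun y => \prod_(i <- r | P i) f i y) x.
Proof.
move=> fx; elim: r => [|i r IH].
  rewrite (_ : (fun y => _) = fun=> 1); first exact: locally_lipschitz_cst.
  by apply/funext => y; rewrite big_nil.
rewrite (_ : (fun y => _) = fun y => if P i then
    f i y * \prod_(j <- r | P j) f j y else \prod_(j <- r | P j) f j y).
  by case: (P i) => //; exact: locally_lipschitzM.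
by apply/funext => y; rewrite big_cons.
Qed.

Lemma locally_lipschitz_det m (A : V -> 'M[R]_m) x :
  (forall i j, locally_lipschitz (fun y => A y i j) x) ->
  locally_lipschitz (fun y => \det (A y)) x.
Proof.
move=> Ax; rewrite /determinant; apply: locally_lipschitz_sum => s.
apply: locally_lipschitzM; first exact: locally_lipschitz_cst.
exact: locally_lipschitz_prod.
Qed.

(** Cramer's rule expresses the entries of the inverse as quotients of
    polynomials in the entries. *)
Lemma locally_lipschitz_invmx m (A : V -> 'M[R]_m) x i j :
  (forall i j, locally_lipschitz (fun y => A y i j) x) ->
  (\near x, A x \in unitmx) ->
  locally_lipschitz (fun y => invmx (A y) i j) x.
Proof.
move=> Ax Au.
apply: (@near_locally_lipschitz (fun y => (\det (A y))^-1 * \adj (A y) i j)).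
  by apply: filterS Au => y Ay; rewrite /invmx Ay !mxE.
apply: locally_lipschitzM.
  apply: locally_lipschitzV; last exact: locally_lipschitz_det.
  by rewrite -unitfE -unitmxE; exact: (nbhs_singleton Au).
under eq_fun do rewrite mxE /cofactor.
apply: locally_lipschitzM; first exact: locally_lipschitz_cst.
apply: locally_lipschitz_det => a b.
by under eq_fun do rewrite !mxE; exact: Ax.
Qed.

End LocallyLipschitz.

Section LipschitzRow.
Context (R : realType).

Lemma nbhs_normP (V : normedModType R) (x : V) (A : set V) : nbhs x A ->
  exists2 r : R, 0 < r & forall y, `|x - y| < r -> A y.
Proof.
move=> /nbhs_ballP[r /= r0 rA]; exists r => // y xy; apply: rA.
by rewrite -ball_normE.
Qed.

(** The mean value theorem along segments: the directional derivatives along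
    the basis vectors are bounded near [x] by continuity, and the derivative
    along a segment is a combination of them. *)
Lemma C1_locally_lipschitz n (f : 'rV[R]_n -> R) x :
  (\near x, differentiable f x) ->
  (forall v, {for x, continuous (fun y => 'D_v f y)}) ->
  locally_lipschitz f x.
Proof.
move=> df cf; pose B i := `|'D_(delta_mx 0 i) f x| + 1.
have : \forall y \near x, differentiable f y /\
    forall i, `|'D_(delta_mx 0 i) f y| <= B i.
  near=> y; split; first by near: y.
  move=> i; move: i; near: y; apply: filter_forall => i.
  by apply: cvgr_norm_le; [exact: cf|rewrite ltrDl].
move=> /nbhs_normP[r r0 rP].
exists (\sum_i B i), (ball x r); split.
- by apply: sumr_ge0 => i _; rewrite addr_ge0.
- exact: nbhsx_ballx.
move=> y z; rewrite -ball_normE /= => xy xz.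
pose g (t : R) := f (t *: (y - z) + z).
have seg (t : R) : t \in `[0, 1] -> `|x - (t *: (y - z) + z)| < r.
  rewrite in_itv /= => /andP[t0 t1].
  have -> : x - (t *: (y - z) + z) = t *: (x - y) + (1 - t) *: (x - z).
    by apply/rowP => i; rewrite !mxE; ring.
  apply: le_lt_trans (ler_normD _ _) _.
  rewrite !normrZ !ger0_norm ?subr_ge0//.
  have [->|tn0] := eqVneq t 0; first by rewrite mul0r add0r subr0 mul1r.
  have -> : r = t * r + (1 - t) * r by ring.
  apply: ltr_leD; first by rewrite ltr_pM2l// lt_neqAle eq_sym tn0.
  by rewrite ler_wpM2l ?subr_ge0// ltW.
have gd (t : R) : t \in `[0, 1] -> is_derive t 1 g ('D_(y - z) f (t *: (y - z) + z)).
  move=> t01; have [dfp _] := rP _ (seg t t01).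
  have [dh Dh] := is_derive_line (y - z) z t.
  move/derivable1_diffP : dh => dh.
  apply: DeriveDef.
    by apply/derivable1_diffP; exact: differentiable_comp.
  by rewrite (@derive_comp _ _ _ _ f (fun t : R => t *: (y - z) + z))// Dh.
have gc : {within `[0, 1], continuous g}.
  apply: continuous_in_subspaceT => t; rewrite inE/= => t01.
  have [] := gd t t01 => dg _; apply: differentiable_continuous.
  exact/derivable1_diffP.
have [t t01 gt] := MVT_segment (@ler01 R) (fun t ht => gd t (subset_itv_oo_cc ht)) gc.
have -> : f y - f z = g 1 - g 0.
  by rewrite /g scale1r subrK scale0r add0r.
rewrite gt subr0 mulr1; have [dfp fB] := rP _ (seg t t01).
rewrite derive_sum_dir// (le_trans (ler_norm_sum _ _ _))// mulr_suml.
apply: ler_sum => i _; rewrite normrM mulrC; apply: ler_pM => //.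
exact: norm_coord.
Unshelve. all: by end_near. Qed.

Lemma locally_lipschitz_row (V : normedModType R) n (f : V -> 'rV[R]_n) x :
  (forall i, locally_lipschitz (fun y => f y 0 i) x) -> locally_lipschitz f x.
Proof.
move=> /(_ _)/cid-/all_sig[L /(_ _)/cid-/all_sig[A fLA]].
exists (\sum_i L i), [set y | forall i, A i y]; split.
- by apply: sumr_ge0 => i _; have [] := fLA i.
- by apply: filter_forall => i; have [] := fLA i.
move=> y z Ay Az; apply: norm_row_le.
  by rewrite mulr_ge0// sumr_ge0// => i _; have [] := fLA i.
move=> i; rewrite !mxE; have [L0 _ fL] := fLA i.
apply: le_trans (fL y z (Ay i) (Az i)) _.
rewrite ler_wpM2r// (bigD1 i)//= lerDl sumr_ge0// => j _.
by have [] := fLA j.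
Qed.

Lemma is_derive_coord n (y : R -> 'rV[R]_n) (t : R) d i :
  is_derive t 1 y d -> is_derive t 1 (fun u => y u 0 i) (d 0 i).
Proof.
move=> [dy <-]; apply: DeriveDef; first by move/derivable_mxP : dy => /(_ 0 i).
by rewrite derive_coord.
Qed.

(** A form of Gronwall's inequality for short times that needs no integral: by
    the mean value theorem, the largest distance [m] between the two solutions
    is at most the initial one plus [(t - s) * L * m <= m / 2]. *)
Lemma ode_estimate m (F : 'rV[R]_m -> 'rV[R]_m) (B : set 'rV[R]_m) (L s t : R)
    (y z : R -> 'rV[R]_m) :
  s <= t -> 0 <= L -> (t - s) * L <= 2^-1 ->
  (forall p q, B p -> B q -> `|F p - F q| <= L * `|p - q|) ->
  (forall u, s <= u <= t -> B (y u) /\ is_derive (u : R) 1 y (F (y u))) ->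
  (forall u, s <= u <= t -> B (z u) /\ is_derive (u : R) 1 z (F (z u))) ->
  forall u, s <= u <= t -> `|y u - z u| <= 2 * `|y s - z s|.
Proof.
move=> st L0 tsL FL yF zF.
have cont (f : R -> 'rV[R]_m) :
    (forall u, s <= u <= t -> B (f u) /\ is_derive (u : R) 1 f (F (f u))) ->
    forall u, u \in `[s, t] -> {for u, continuous f}.
  move=> fF u; rewrite in_itv/= => /fF[_ [df _]].
  exact/differentiable_continuous/derivable1_diffP.
have cd : {within `[s, t], continuous (fun u => `|y u - z u|)}.
  apply: continuous_in_subspaceT => u; rewrite inE/= => ust.
  by apply: cvg_norm; apply: cvgB; [exact: cont ust|exact: cont ust].
have [c cst cmax] := EVT_max st cd.
suff cle : `|y c - z c| <= 2 * `|y s - z s|.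
  by move=> u ust; apply: le_trans cle; apply: cmax; rewrite in_itv.
have cM : `|y c - z c| <= `|y s - z s| + 2^-1 * `|y c - z c|.
  apply: norm_row_le => [|i]; first by rewrite addr_ge0// mulr_ge0.
  move: (cst); rewrite in_itv/= => /andP[sc ct].
  have sub u : s <= u <= c -> s <= u <= t.
    by move=> /andP[-> uc]; rewrite (le_trans uc).
  have der u : s <= u <= c -> is_derive (u : R) 1 (fun v => y v 0 i - z v 0 i)
      (F (y u) 0 i - F (z u) 0 i).
    move=> /sub ust; have [_ dy] := yF _ ust; have [_ dz] := zF _ ust.
    by apply: is_deriveB; exact: is_derive_coord.
  have [||e esc eqe] := @MVT_segment R (fun v => y v 0 i - z v 0 i)
    (fun u => F (y u) 0 i - F (z u) 0 i) s c sc.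
  - by move=> u /subset_itv_oo_cc; rewrite in_itv/=; exact: der.
  - apply: continuous_in_subspaceT => u; rewrite inE/= in_itv/= => /der[du _].
    exact/differentiable_continuous/derivable1_diffP.
  have est : s <= e <= t by apply: sub; move: esc; rewrite in_itv.
  rewrite !mxE -[y c 0 i - z c 0 i](subrK (y s 0 i - z s 0 i)) eqe addrC.
  apply: le_trans (ler_normD _ _) _; apply: lerD.
    by have := norm_coord (y s - z s) i; rewrite !mxE.
  rewrite normrM (ger0_norm (x := c - s)) ?subr_ge0//.
  have F1 : `|F (y e) 0 i - F (z e) 0 i| <= L * `|y c - z c|.
    have := norm_coord (F (y e) - F (z e)) i; rewrite !mxE => /le_trans; apply.
    have [By _] := yF _ est; have [Bz _] := zF _ est.
    apply: le_trans (FL _ _ By Bz) _; rewrite ler_wpM2l// cmax// in_itv//.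
  have F2 : (c - s) * L <= 2^-1.
    by apply: le_trans tsL; rewrite ler_wpM2r// lerD2r.
  have : `|F (y e) 0 i - F (z e) 0 i| * (c - s) <= L * `|y c - z c| * (c - s).
    by rewrite ler_wpM2r// subr_ge0.
  move/le_trans; apply; rewrite mulrAC [L * _]mulrC ler_wpM2r//.
lra.
Qed.

End LipschitzRow.

(** * Charts, the metric in charts and the geodesic field *)

Section RowDerive.
Context (R : realType).

Lemma is_derive_row n (y : R -> 'rV[R]_n) (t : R) (d : 'rV[R]_n) :
  (forall i, is_derive t 1 (fun u => y u 0 i) (d 0 i)) -> is_derive t 1 y d.
Proof.
move=> yd; have dy : derivable y t 1.
  by apply/derivable_mxP => i j; rewrite ord1; have [] := yd j.
apply: DeriveDef => //; apply/rowP => i.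
by rewrite derive_coord//; have [_ ->] := yd i.
Qed.

Lemma locally_lipschitz_coord n (x : 'rV[R]_n) i :
  locally_lipschitz (fun y : 'rV[R]_n => y 0 i) x.
Proof.
exists 1, setT; split => //; first exact: filterT.
by move=> y z _ _; rewrite mul1r; have := norm_coord (y - z) i; rewrite !mxE.
Qed.

Lemma norm_lsubmx m n (x : 'rV[R]_(m + n)) : `|lsubmx x| <= `|x|.
Proof. by apply: norm_row_le => // i; rewrite mxE norm_coord. Qed.

Lemma locally_lipschitz_lsubmx m n (f : 'rV[R]_m -> R) (x : 'rV[R]_(m + n)) :
  locally_lipschitz f (lsubmx x) -> locally_lipschitz (fun y => f (lsubmx y)) x.
Proof.
move=> [L [A [L0 /nbhs_normP[r r0 rA] fL]]].
exists L, (ball x r); split=> //; first exact: nbhsx_ballx.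
move=> y z; rewrite -ball_normE/= => xy xz.
have near_l w : `|x - w| < r -> A (lsubmx w).
  by move=> xw; apply: rA; rewrite -linearB (le_lt_trans (norm_lsubmx _)).
apply: le_trans (fL _ _ (near_l _ xy) (near_l _ xz)) _.
by rewrite ler_wpM2l// -linearB norm_lsubmx.
Qed.

End RowDerive.

Section Smooth.
Context (R : realType) (V W : normedModType R) (U : set V) (f : V -> W).
Context (sf : smooth U f).

Lemma smooth_differentiable x : U x -> differentiable f x.
Proof. by move=> Ux; have [+ _] := sf 1; exact. Qed.

Lemma smooth_continuous x : U x -> {for x, continuous f}.
Proof. by move=> /smooth_differentiable; exact: differentiable_continuous. Qed.

Lemma smooth_derive v : smooth U (fun x => 'D_v f x).
Proof. by move=> k; have [_] := sf k.+1; exact. Qed.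

End Smooth.

Lemma smooth_locally_lipschitz (R : realType) n (U : set 'rV[R]_n)
    (f : 'rV[R]_n -> R) x :
  open U -> U x -> smooth U f -> locally_lipschitz f x.
Proof.
move=> oU Ux sf; apply: C1_locally_lipschitz.
  have : nbhs x U by exact: open_nbhs_nbhs.
  by apply: filterS => y; exact: smooth_differentiable.
by move=> v; exact: (smooth_continuous (smooth_derive sf v)).
Qed.

Section Charts.
Context (R : realType) (n : nat) (M : manifold R n).
Implicit Types (i j k : chart M) (p : M).

Lemma near_dom i p : dom i p -> \forall q \near p, dom i q.
Proof. by move=> ip; apply: open_nbhs_nbhs; split=> //; exact: dom_open. Qed.

Lemma near_psi i p : dom i p -> psi i @ phi i p --> p.
Proof.
move=> ip; rewrite -{2}(phiK ip); apply: psi_continuous; by exists p.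
Qed.

Lemma near_transition i j p : dom i p -> dom j p ->
  \forall u \near phi i p, (phi i @` (dom i `&` dom j)) u.
Proof.
move=> ip jp.
have Ci : \forall u \near phi i p, (phi i @` dom i) u.
  by apply: open_nbhs_nbhs; split; [exact: cod_open|exists p].
have Dj : \forall u \near phi i p, dom j (psi i u).
  exact: (near_psi ip (near_dom jp)).
apply: filterS2 Ci Dj => u [q iq <-]; rewrite phiK// => jq.
by exists q.
Qed.

Definition transition i j : 'rV[R]_n -> 'rV[R]_n := phi j \o psi i.

Lemma transition_differentiable i j p : dom i p -> dom j p ->
  differentiable (transition i j) (phi i p).
Proof.
by move=> ip jp; apply: (smooth_differentiable (transition_smooth i j)); exists p.
Qed.

Lemma transitionE i j p : dom i p -> transition i j (phi i p) = phi j p.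
Proof. by move=> ip; rewrite /transition/= phiK. Qed.

(** The base point is a point of the manifold rather than its coordinates, so
    that the cocycle identities hold without mentioning the coordinate maps. *)
Definition dtrans i j p v := 'D_v (transition i j) (phi i p).

Lemma dtrans_comp i j k p v : dom i p -> dom j p -> dom k p ->
  dtrans j k p (dtrans i j p v) = dtrans i k p v.
Proof.
move=> ip jp kp; rewrite /dtrans -{1}(transitionE j ip).
rewrite -derive_comp; first last.
- by rewrite transitionE//; exact: transition_differentiable.
- exact: transition_differentiable.
apply: near_eq_derive; apply: filterS (near_transition ip jp) => u [q [iq jq] <-].
by rewrite /= !transitionE.
Qed.

Lemma dtrans_id i p v : dom i p -> dtrans i i p v = v.
Proof.
move=> ip; rewrite /dtrans.
rewrite (@near_eq_derive _ _ _ _ id) ?derive_id//.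
by apply: filterS (near_transition ip ip) => u [q [iq _] <-]; rewrite transitionE.
Qed.

Lemma dtransK i j p : dom i p -> dom j p -> cancel (dtrans i j p) (dtrans j i p).
Proof. by move=> ip jp v; rewrite dtrans_comp// dtrans_id. Qed.

Lemma dtrans_sum i j p v : dom i p -> dom j p ->
  dtrans i j p v = \sum_(a < n) v 0 a *: dtrans i j p (delta_mx 0 a).
Proof.
by move=> ip jp; apply: derive_sum_dir; exact: transition_differentiable.
Qed.

Lemma dtrans_continuous i j p v : dom i p -> dom j p ->
  {for phi i p, continuous (fun u => 'D_v (transition i j) u)}.
Proof.
move=> ip jp; apply: (smooth_continuous (smooth_derive (transition_smooth i j) v)).
by exists p.
Qed.

Lemma coord_vectorE i a p : dom i p ->
  coord_vector i a (phi i p) = dtrans i (chart_at p) p (delta_mx 0 a).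
Proof. by move=> ip; rewrite /coord_vector /tangent_map phiK. Qed.

Lemma smooth_map_differentiable (V : normedModType R) (U : set V) (F : V -> M) u i :
  smooth_map U F -> U u -> dom i (F u) -> differentiable (phi i \o F) u.
Proof. by move=> [_ sF] Uu iF; apply: (smooth_differentiable (sF i)). Qed.

Lemma derive_transition (V : normedModType R) (U : set V) (F : V -> M) u i j w :
  smooth_map U F -> U u -> dom i (F u) -> dom j (F u) ->
  'D_w (phi j \o F) u = dtrans i j (F u) ('D_w (phi i \o F) u).
Proof.
move=> sF Uu iF jF.
have dF := smooth_map_differentiable sF Uu iF.
rewrite /dtrans -(@derive_comp _ _ _ _ _ (phi i \o F))//; last first.
  exact: transition_differentiable.
apply: near_eq_derive.
have [cF _] := sF.
have Fi : \forall v \near u, dom i (F v) := cF u Uu _ (near_dom iF).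
apply: filterS Fi => v /= iv.
by rewrite transitionE.
Qed.

Lemma velocityE (J : set R) (c : R -> M) t i :
  smooth_map J c -> J t -> dom i (c t) ->
  velocity c t = dtrans i (chart_at (c t)) (c t) ('D_1 (phi i \o c) t).
Proof.
move=> sc Jt ic; rewrite /velocity /tangent_map.
by apply: (derive_transition _ sc Jt ic); exact: chart_at_dom.
Qed.

End Charts.

Section Bilin.
Context (R : realType) (n : nat) (A : 'M[R]_n).

Lemma bilinDl u v w : bilin A (u + v) w = bilin A u w + bilin A v w.
Proof. by rewrite /bilin !mulmxDl mxE. Qed.

Lemma bilinZl a u w : bilin A (a *: u) w = a * bilin A u w.
Proof. by rewrite /bilin -!scalemxAl mxE. Qed.

Lemma bilinDr u v w : bilin A w (u + v) = bilin A w u + bilin A w v.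
Proof. by rewrite /bilin linearD mulmxDr mxE. Qed.

Lemma bilinZr a u w : bilin A w (a *: u) = a * bilin A w u.
Proof. by rewrite /bilin linearZ -scalemxAr mxE. Qed.

Lemma bilin0l u : bilin A 0 u = 0.
Proof. by rewrite /bilin !mul0mx mxE. Qed.

Lemma bilin0r u : bilin A u 0 = 0.
Proof. by rewrite /bilin linear0 mulmx0 mxE. Qed.

Lemma bilin_suml m (f : 'I_m -> 'rV[R]_n) w :
  bilin A (\sum_i f i) w = \sum_i bilin A (f i) w.
Proof.
by apply: (big_morph (fun u => bilin A u w)) => [u v|];
  rewrite ?bilinDl ?bilin0l.
Qed.

Lemma bilin_sumr m (f : 'I_m -> 'rV[R]_n) w :
  bilin A w (\sum_i f i) = \sum_i bilin A w (f i).
Proof.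
by apply: (big_morph (fun u => bilin A w u)) => [u v|];
  rewrite ?bilinDr ?bilin0r.
Qed.

Lemma bilinE u v : bilin A u v = \sum_(a < n) \sum_(b < n) u 0 a * v 0 b * A a b.
Proof.
rewrite /bilin mxE exchange_big; apply: eq_bigr => b _; rewrite !mxE mulr_suml.
by apply: eq_bigr => a _; rewrite mulrAC.
Qed.

(** A positive definite form has no kernel. *)
Lemma pos_unitmx : (forall v, v != 0 -> 0 < bilin A v v) -> A \in unitmx.
Proof.
move=> pos; rewrite -row_free_unit; apply: inj_row_free => v vA.
apply: contraTeq isT => /pos.
by rewrite /bilin vA mul0mx mxE ltxx.
Qed.

End Bilin.

Section Metric.
Context (R : realType) (n : nat) (M : manifold R n) (g : metric M).
Implicit Types (i j k : chart M) (p : M).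

(** Chart vectors are carried to the tangent space by the differential of the
    change to the preferred chart. *)
Lemma local_gram_bilin i p v w : dom i p ->
  bilin (local_gram g i (phi i p)) v w =
  inner g p (dtrans i (chart_at p) p v) (dtrans i (chart_at p) p w).
Proof.
move=> ip; have cp := chart_at_dom p.
rewrite (dtrans_sum v ip cp) (dtrans_sum w ip cp) /inner bilin_suml bilinE.
apply: eq_bigr => a _; rewrite bilin_sumr; apply: eq_bigr => b _.
by rewrite bilinZl bilinZr mxE /inner !coord_vectorE// phiK// mulrA.
Qed.

(** Changes of chart have invertible differentials, so that the local Gram
    matrix is positive definite too. *)
Lemma local_gram_unit i p : dom i p -> local_gram g i (phi i p) \in unitmx.
Proof.
move=> ip; have cp := chart_at_dom p; apply: pos_unitmx => v v0.
rewrite local_gram_bilin// gram_pos//.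
apply: contraNneq v0 => Dv; rewrite -(dtransK ip cp v) Dv.
by rewrite /dtrans derive0.
Qed.

Lemma local_gram_smooth i a b :
  smooth (phi i @` dom i) (fun u => local_gram g i u a b).
Proof.
by under eq_fun do rewrite mxE; exact: gram_smooth.
Qed.

(** The Christoffel symbols are rational in the metric coefficients and their
    first derivatives, which are smooth. *)
Lemma christoffel_lipschitz i p (k a b : 'I_n) : dom i p ->
  locally_lipschitz (fun u => christoffel g i u k a b) (phi i p).
Proof.
move=> ip; have oC := @cod_open _ _ _ i.
have Cp : (phi i @` dom i) (phi i p) by exists p.
have dG c d e : locally_lipschitz
    (fun u => 'D_(delta_mx 0 c) (fun u' => local_gram g i u' d e) u) (phi i p).
  by apply: (smooth_locally_lipschitz oC Cp); apply: smooth_derive;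
    exact: local_gram_smooth.
rewrite /christoffel; apply: locally_lipschitzM; first exact: locally_lipschitz_cst.
apply: locally_lipschitz_sum => l; apply: locally_lipschitzM.
  apply: locally_lipschitz_invmx.
    by move=> d e; exact: (smooth_locally_lipschitz oC Cp (@local_gram_smooth i d e)).
  have : \forall u \near phi i p, (phi i @` dom i) u by apply: open_nbhs_nbhs.
  by apply: filterS => u [q iq <-]; exact: local_gram_unit.
apply: locally_lipschitzD; first exact: locally_lipschitzD.
under eq_fun do rewrite -mulN1r.
by apply: locally_lipschitzM => //; exact: locally_lipschitz_cst.
Qed.

(** The geodesic equation as a first order system on positions and
    velocities. *)
Definition geodesic_field i (p : 'rV[R]_(n + n)) : 'rV[R]_(n + n) :=
  row_mx (rsubmx p) (\row_k - \sum_(a < n) \sum_(b < n)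
    christoffel g i (lsubmx p) k a b * rsubmx p 0 a * rsubmx p 0 b).

Lemma geodesic_field_lipschitz i p v : dom i p ->
  locally_lipschitz (geodesic_field i) (row_mx (phi i p) v).
Proof.
move=> ip; apply: locally_lipschitz_row => l.
have coordr (a : 'I_n) : locally_lipschitz
    (fun y : 'rV[R]_(n + n) => rsubmx y 0 a) (row_mx (phi i p) v).
  by under eq_fun do rewrite mxE; exact: locally_lipschitz_coord.
rewrite -[l]splitK; case: (fintype.split l) => k /=.
  by under eq_fun do rewrite row_mxEl; exact: coordr.
under eq_fun do rewrite row_mxEr mxE -mulN1r.
apply: locally_lipschitzM; first exact: locally_lipschitz_cst.
apply: locally_lipschitz_sum => a; apply: locally_lipschitz_sum => b.
apply: locally_lipschitzM => //; apply: locally_lipschitzM => //.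
apply: (@locally_lipschitz_lsubmx _ _ _ (fun u => christoffel g i u k a b)).
by rewrite row_mxKl; exact: christoffel_lipschitz.
Qed.

(** The unknown of the first order system: position and velocity in a chart. *)
Definition state i (c : R -> M) (t : R) : 'rV[R]_(n + n) :=
  row_mx (phi i (c t)) (derive1 (phi i \o c) t).

Lemma geodesic_state J (c : R -> M) t i : geodesic_on g J c -> J t -> dom i (c t) ->
  is_derive t 1 (state i c) (geodesic_field i (state i c t)).
Proof.
move=> [sc geo] Jt ic; have [_ /(_ i) sic] := sc.
have dx : derivable (phi i \o c) t 1.
  by apply/derivable1_diffP; exact: (smooth_map_differentiable sc Jt ic).
have ddx : derivable (derive1 (phi i \o c)) t 1.
  apply/derivable1_diffP; rewrite (_ : derive1 _ = fun t => 'D_1 (phi i \o c) t).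
    by apply: (smooth_differentiable (smooth_derive sic 1)); split.
  by apply/funext => u; rewrite derive1E.
apply: is_derive_row => l; rewrite /state /geodesic_field row_mxKl row_mxKr.
rewrite -[l]splitK; case: (fintype.split l) => k /=.
  under eq_fun do rewrite row_mxEl.
  rewrite row_mxEl; apply: (@is_derive_coord _ _ (phi i \o c)).
  by apply: DeriveDef; [exact: dx|exact/esym/derive1E].
under eq_fun do rewrite row_mxEr.
rewrite row_mxEr mxE; have /eqP := geo i t k Jt ic.
rewrite addr_eq0 => /eqP <-; apply: is_derive_coord.
by apply: DeriveDef; [exact: ddx|exact/esym/derive1E].
Qed.

Lemma state_continuous J (c : R -> M) t i : geodesic_on g J c -> J t -> dom i (c t) ->
  {for t, continuous (state i c)}.
Proof.
move=> geo Jt ic; have [ds _] := geodesic_state geo Jt ic.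
exact/differentiable_continuous/derivable1_diffP.
Qed.

Lemma speedE J (c : R -> M) t i : smooth_map J c -> J t -> dom i (c t) ->
  speed g c t = Num.sqrt (bilin (local_gram g i (phi i (c t)))
    (derive1 (phi i \o c) t) (derive1 (phi i \o c) t)).
Proof.
move=> sc Jt ic; rewrite derive1E (local_gram_bilin _ _ ic).
rewrite -(velocityE sc Jt ic); reflexivity.
Qed.

End Metric.

(** * Continuous dependence of geodesics on their initial velocity *)

Lemma closed_left_limit (R : realType) (T : topologicalType) (C : set T)
    (f : R -> T) (s x : R) :
  closed C -> {for x, continuous f} -> s < x ->
  (forall v, s <= v < x -> C (f v)) -> C (f x).
Proof.
move=> Ccl fc sx fC; apply: Ccl => A /fc /nbhs_ballP[r /= r0 rA].
pose v := Num.max s (x - r / 2).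
have vx : v < x by rewrite gt_max sx/= ltrBlDr ltrDl divr_gt0.
exists (f v); split.
  by apply: fC; rewrite vx andbT le_max lexx.
apply: rA; rewrite -ball_normE /= ger0_norm ?subr_ge0 ?ltW//.
rewrite ltrBlDr -ltrBlDl lt_max; apply/orP; right.
by rewrite ltrD2l ltrN2 ltr_pdivrMr// ltr_pMr// ltr1n.
Qed.

Lemma closed_norm_le (R : realType) (V : normedModType R) (x : V) (e : R) :
  closed [set y | `|x - y| <= e].
Proof.
apply: (@preimage_closed _ _ (fun y => `|x - y|) [set u | u <= e]).
  by move=> y _; apply: cvg_norm; apply: cvgB; [exact: cvg_cst|exact: cvg_id].
exact: closed_le.
Qed.

Lemma compact_norm_le (R : realType) n (x : 'rV[R]_n) (e : R) :
  compact [set y | `|x - y| <= e].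
Proof.
apply: bounded_closed_compact; last exact: closed_norm_le.
exists (`|x| + e); split; first exact: num_real.
move=> M xeM y /= xy; apply: ltW; apply: le_lt_trans xeM.
have -> : y = x - (x - y) by rewrite opprB addrC subrK.
by apply: le_trans (ler_normB _ _) _; rewrite lerD2l.
Qed.

Lemma right_nbhs (R : realType) (x : R) (A : set R) : nbhs x A ->
  exists2 e, 0 < e & forall y, x - e < y < x + e -> A y.
Proof.
move=> /nbhs_normP[e e0 eA]; exists e => // y /andP[xy yx].
by apply: eA; rewrite ltr_distlC xy yx.
Qed.

Lemma continuous_near (R : realType) (V : normedModType R) (f : R -> V) (t e : R) :
  {for t, continuous f} -> 0 < e -> \forall u \near t, `|f t - f u| < e.
Proof. by move=> /cvgrPdist_lt fc e0; exact: fc. Qed.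

(** Bookkeeping for the bootstrapping below, where a radius [r] is spent in
    quarters: one for the motion of the reference geodesic, two for the
    deviation from it, one to leave some room. *)
Section Constants.
Context (R : realType).
Implicit Types p q d e r L : R.

Lemma quarter_bound p q d r :
  p < r / 4 -> q <= 2 * d -> d < r / 4 -> p + q <= 3 / 4 * r.
Proof. by move=> *; lra. Qed.

Lemma quarter_lt p r : 0 < r -> p < r / 4 -> p < r.
Proof. by move=> *; lra. Qed.

Lemma three_quarters_lt p r : 0 < r -> p <= 3 / 4 * r -> p < r.
Proof. by move=> *; lra. Qed.

Lemma quarters_lt p q r : p <= 3 / 4 * r -> q < r / 4 -> p + q < r.
Proof. by move=> *; lra. Qed.

Lemma short_step e L : 0 <= L -> 0 < e -> e <= (4 * (L + 1))^-1 -> 4 * e * L <= 1.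
Proof.
move=> L0 e0; rewrite -[X in _ <= X]mul1r ler_pdivlMr ?mulr_gt0 ?ltr_wpDl//.
by move=> ?; nra.
Qed.

Lemma short_interval e L t0 s u t : 0 <= L -> 4 * e * L <= 1 ->
  t0 - e < s -> u <= t -> t < t0 + e -> (u - s) * L <= 2^-1.
Proof.
move=> L0 eL es ut te; have us : u - s <= 2 * e by lra.
have : (u - s) * L <= 2 * e * L by rewrite ler_wpM2r.
by move=> ?; lra.
Qed.

Lemma halved p q e : q <= 2 * p -> p <= e / 2 -> q <= e.
Proof. by move=> *; lra. Qed.

End Constants.

Lemma state_lshift (R : realType) n (M : manifold R n) (i : chart M) c t k :
  state i c t 0 (lshift n k) = phi i (c t) 0 k.
Proof. exact: row_mxEl. Qed.

Lemma state_rshift (R : realType) n (M : manifold R n) (i : chart M) c t k :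
  state i c t 0 (rshift n k) = derive1 (phi i \o c) t 0 k.
Proof. exact: row_mxEr. Qed.

Section Dependence.
Context (R : realType) (n : nat) (M : manifold R n) (g : metric M).
Context (c : R -> M) (c_geo : geodesic_on g setT c).

Let c_cont t : {for t, continuous c}.
Proof. by have [[+ _] _] := c_geo; apply. Qed.

(** Another geodesic [h] stays close to [c] as long as it remains in the chart,
    by [ode_estimate]. It cannot leave the chart: while it is close to [c], its
    coordinates stay in a closed ball around those of [c t0], whose image in the
    manifold is compact, hence closed because the manifold is Hausdorff. The
    domain [J] of [h] is arbitrary, because minimizing geodesics are geodesics
    only near their interval of definition. *)
Lemma local_dependence (i : chart M) (t0 : R) : dom i (c t0) ->
  exists e r : R, [/\ 0 < e, 0 < r,
    forall t, t0 - e < t < t0 + e -> dom i (c t)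
    & forall (J : set R) (h : R -> M) (s t : R), geodesic_on g J h ->
        (forall u, s <= u <= t -> J u) -> t0 - e < s -> s <= t -> t < t0 + e ->
        dom i (h s) -> `|state i h s - state i c s| < r ->
        dom i (h t) /\
        `|state i h t - state i c t| <= 2 * `|state i h s - state i c s|].
Proof.
move=> ic; pose z := state i c; pose z0 := z t0.
have [L [A [L0 /nbhs_normP[r1 r10 r1A] FL]]] := geodesic_field_lipschitz g
  (derive1 (phi i \o c) t0) ic.
have /nbhs_normP[r2 r20 r2C] : \forall u \near phi i (c t0), (phi i @` dom i) u.
  by apply: open_nbhs_nbhs; split; [exact: cod_open|exists (c t0)].
pose r := Num.min r1 r2.
have r0 : 0 < r by rewrite lt_min r10.
have r40 : 0 < r / 4 by rewrite divr_gt0.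
have rr1 : r <= r1 by rewrite ge_min lexx.
have rr2 : r <= r2 by rewrite ge_min lexx orbT.
have nz : \forall t \near t0, dom i (c t) /\ `|z0 - z t| < r / 4.
  have d1 : \forall t \near t0, dom i (c t) := c_cont (near_dom ic).
  have d2 : \forall t \near t0, `|z0 - z t| < r / 4.
    exact: (continuous_near (state_continuous c_geo I ic) r40).
  by apply: filterS2 d1 d2 => t.
have [e1 e10 e1P] := right_nbhs nz.
pose e := Num.min e1 (4 * (L + 1))^-1.
have e0 : 0 < e by rewrite lt_min e10 invr_gt0 mulr_gt0// ltr_wpDl.
have ee1 : e <= e1 by rewrite ge_min lexx.
have eL : 4 * e * L <= 1 by apply: short_step => //; rewrite ge_min lexx orbT.
have cP t : t0 - e < t < t0 + e -> dom i (c t) /\ `|z0 - z t| < r / 4.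
  move=> /andP[t1 t2]; apply: e1P; apply/andP; split.
    by apply: le_lt_trans t1; rewrite lerB.
  by apply: lt_le_trans t2 _; rewrite lerD2l.
exists e, (r / 4); split=> //.
  by move=> t /cP[].
move=> J h s t hgeo sub es st te hs.
pose d := `|state i h s - state i c s|; change (d < r / 4 -> dom i (h t) /\
  `|state i h t - state i c t| <= 2 * d) => dr.
pose y := state i h.
have range u : s <= u <= t -> t0 - e < u < t0 + e.
  by move=> /andP[su ut]; rewrite (lt_le_trans es)// (le_lt_trans ut).
have inB u : s <= u <= t -> `|y u - z u| <= 2 * d -> `|z0 - y u| <= 3 / 4 * r.
  move=> /range/cP[_ zu] yz.
  have -> : z0 - y u = (z0 - z u) - (y u - z u) by rewrite opprB addrA subrK.
  by apply: le_trans (ler_normB _ _) _; exact: (quarter_bound zu yz dr).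
have estimate u : s <= u <= t ->
    (forall v, s <= v <= u -> dom i (h v) /\ `|z0 - y v| < r) ->
    `|y u - z u| <= 2 * d.
  move=> /andP[su ut] hB.
  have sub' v : s <= v <= u -> s <= v <= t.
    by move=> /andP[-> vu]; rewrite (le_trans vu).
  apply: (@ode_estimate R _ (geodesic_field g i) [set p | `|z0 - p| < r] L s u) => //.
  - exact: (short_interval L0 eL es ut te).
  - move=> p q /= zp zq; apply: FL; apply: r1A.
      exact: lt_le_trans zp rr1.
    exact: lt_le_trans zq rr1.
  - move=> v sv; have [iv yv] := hB v sv; split=> //.
    exact: (geodesic_state hgeo (sub _ (sub' _ sv)) iv).
  - move=> v sv; have [iv zv] := cP _ (range _ (sub' _ sv)); split.
      exact: quarter_lt zv.
    exact: (geodesic_state c_geo I iv).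
  - by rewrite su lexx.
pose P u := dom i (h u) /\ `|y u - z u| <= 2 * d.
suff : forall u, s <= u <= t -> P u by apply; rewrite st lexx.
apply: real_induction.
- by split=> //; rewrite ler_peMl// ler1n.
- move=> x /andP[sx xt] Px.
  have sxt : s <= x <= t by rewrite sx ltW.
  have [ix yx] := Px x (ltac:(by rewrite sx lexx)).
  have h_cont : {for x, continuous h}.
    by have [[hc _] _] := hgeo; exact: (hc x (sub x sxt)).
  have near1 : \forall v \near x, dom i (h v) := h_cont _ (near_dom ix).
  have near2 : \forall v \near x, `|z0 - y v| < r.
    have yc := state_continuous hgeo (sub x sxt) ix.
    have zy := inB x sxt yx.
    have : \forall v \near x, `|y x - y v| < r / 4.
      exact: (continuous_near yc r40).
    apply: filterS => v yxv.
    have -> : z0 - y v = (z0 - y x) + (y x - y v) by rewrite addrA subrK.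
    apply: le_lt_trans (ler_normD _ _) _; exact: quarters_lt zy yxv.
  have [e' e'0 eP] := right_nbhs (filterI near1 near2).
  exists e'; first exact: e'0.
  move=> v /andP[xv vx] vt.
  have good w : s <= w <= v -> dom i (h w) /\ `|z0 - y w| < r.
    move=> /andP[sw wv]; have [wx|xw] := leP w x.
      have swt : s <= w <= t by rewrite sw (le_trans wv).
      have [iw yw] := Px w (ltac:(by rewrite sw)); split=> //.
      exact: (three_quarters_lt r0 (inB _ swt yw)).
    by apply: eP; rewrite (lt_trans _ xw)/= ?(le_lt_trans wv)// ltrBlDr ltrDl.
  have sv : s <= v by rewrite (le_trans sx)// ltW.
  split; first by have [] := good v (ltac:(by rewrite sv lexx)).
  by apply: (estimate v _ good); rewrite sv.
- move=> x /andP[sx xt] Px.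
  have sxt : s <= x <= t by rewrite ltW.
  have sub' v : s <= v < x -> s <= v <= t.
    by move=> /andP[-> vx]; rewrite (le_trans (ltW vx)).
  have inB' v : s <= v < x -> `|z0 - y v| <= 3 / 4 * r.
    by move=> sv; have [_ /inB] := Px v sv; apply; exact: sub'.
  (* the limit point stays in the chart: psi maps a closed ball onto a
     compact, hence closed, subset of the domain *)
  pose N := psi i @` [set u | `|phi i (c t0) - u| <= 3 / 4 * r].
  have ballC u : `|phi i (c t0) - u| <= 3 / 4 * r -> (phi i @` dom i) u.
    by move=> ur; apply: r2C; apply: lt_le_trans rr2; exact: three_quarters_lt ur.
  have Ncl : closed N.
    apply: compact_closed; first exact: pt_hausdorff.
    apply: continuous_compact; last exact: compact_norm_le.
    apply: continuous_in_subspaceT => u; rewrite inE /= => /ballC.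
    exact: psi_continuous.
  have h_cont : {for x, continuous h}.
    by have [[hc _] _] := hgeo; exact: (hc x (sub x sxt)).
  have [u ur ux] : N (h x).
    apply: (closed_left_limit Ncl h_cont sx) => v sv.
    have [iv _] := Px v sv; exists (phi i (h v)); last exact: phiK.
    have := norm_lsubmx (z0 - y v); rewrite /z0 /y /z /state.
    rewrite opp_row_mx add_row_mx row_mxKl => /le_trans; apply.
    by have := inB' v sv; rewrite /z0 /y /z /state opp_row_mx add_row_mx.
  have ix : dom i (h x) by have [q iq qu] := ballC _ ur; rewrite -ux -qu phiK.
  have yx : `|z0 - y x| <= 3 / 4 * r.
    apply: (closed_left_limit (C := [set p | `|z0 - p| <= 3 / 4 * r])
      (f := y) (s := s)) => //.
      exact: closed_norm_le.
    exact: (state_continuous hgeo (sub x sxt) ix).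
  split; first exact: ix.
  apply: (estimate x sxt) => v /andP[sv].
  rewrite le_eqVlt => /predU1P[->|vx]; first by split=> //; exact: three_quarters_lt yx.
  have svx : s <= v < x by rewrite sv.
  have [iv _] := Px v svx; split=> //.
  exact: three_quarters_lt (inB' v svx).
Qed.

Context (I : Type) (F : set_system I) {FF : ProperFilter F}.
Context (a : R) (h : I -> R -> M) (J : I -> set R).
Context (h_geo : forall l, geodesic_on g (J l) (h l)).
Context (h_sub : forall l t, 0 <= t <= a -> J l t).

(** Pointwise convergence of a family of geodesics to [c], together with their
    velocities. A filter on the index type covers the case of ultrafilters,
    which is the one needed for compactness. *)
Definition converges_at (i : chart M) (t : R) : Prop :=
  (\forall l \near F, dom i (h l t)) /\
  state i (h l) t @[l --> F] --> state i c t.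

Lemma converges_at_pos i t : dom i (c t) -> converges_at i t ->
  phi i (h l t) @[l --> F] --> phi i (c t).
Proof.
move=> ic [_ sc]; apply: cvg_row => k.
have := cvg_row_coord (i := lshift n k) sc.
rewrite state_lshift; under eq_cvg do rewrite state_lshift.
exact.
Qed.

Lemma converges_at_vel i t : dom i (c t) -> converges_at i t ->
  derive1 (phi i \o h l) t @[l --> F] --> derive1 (phi i \o c) t.
Proof.
move=> ic [_ sc]; apply: cvg_row => k.
have := cvg_row_coord (i := rshift n k) sc.
rewrite state_rshift; under eq_cvg do rewrite state_rshift.
exact.
Qed.

Lemma converges_at_cvg i t : dom i (c t) -> converges_at i t ->
  h l t @[l --> F] --> c t.
Proof.
move=> ic cv; have xc := converges_at_pos ic cv; have [di _] := cv.
have pc : psi i (phi i (h l t)) @[l --> F] --> c t.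
  by apply: cvg_comp xc _; exact: near_psi.
apply: cvg_trans pc; apply: near_eq_cvg.
by apply: (@filterS _ F _ _ _ _ di) => l il; rewrite phiK.
Qed.

(** Velocities transform by the differential of the change of chart, taken at
    the moving base point; it is continuous there. *)
Lemma converges_at_chart i j t : 0 <= t <= a -> dom i (c t) -> dom j (c t) ->
  converges_at i t -> converges_at j t.
Proof.
move=> ta ic jc cv; have hc := converges_at_cvg ic cv.
have dj : \forall l \near F, dom j (h l t) := hc _ (near_dom jc).
split; first exact: dj.
apply: cvg_row => m.
rewrite -[m]splitK; case: (fintype.split m) => k /=.
  rewrite state_lshift; under eq_cvg do rewrite state_lshift.
  apply: cvg_row_coord; apply: cvg_comp hc _; exact: phi_continuous.
rewrite state_rshift; under eq_cvg do rewrite state_rshift.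
apply: cvg_row_coord; have [di _] := cv.
have chain (f : R -> M) (K : set R) : smooth_map K f -> K t -> dom i (f t) ->
    dom j (f t) -> derive1 (phi j \o f) t = \sum_(b < n)
      derive1 (phi i \o f) t 0 b *: 'D_(delta_mx 0 b) (transition i j) (phi i (f t)).
  move=> sf Kt ifd jfd; rewrite !derive1E (derive_transition _ sf Kt ifd jfd).
  exact: dtrans_sum.
have [c_smooth _] := c_geo; rewrite (chain c setT)//.
have : \sum_(b < n) derive1 (phi i \o h l) t 0 b *:
    'D_(delta_mx 0 b) (transition i j) (phi i (h l t)) @[l --> F] -->
    \sum_(b < n) derive1 (phi i \o c) t 0 b *:
    'D_(delta_mx 0 b) (transition i j) (phi i (c t)).
  apply: cvg_sumr => b; apply: cvgZ.
    by apply: cvg_row_coord; exact: converges_at_vel.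
  exact: (@continuous_cvg _ _ _ F _ (fun l => phi i (h l t))
    (fun u => 'D_(delta_mx 0 b) (transition i j) u) _
    (@dtrans_continuous _ _ M i j _ (delta_mx 0 b) ic jc)
    (converges_at_pos ic cv)).
apply: cvg_trans; apply: near_eq_cvg.
have dij : F [set l | dom i (h l t) /\ dom j (h l t)] by exact: filterI di dj.
apply: (@filterS _ F _ _ _ _ dij) => l [il jl]; have [h_smooth _] := h_geo l.
rewrite (chain (h l) (J l)); [|exact: h_smooth|exact: h_sub|exact: il|exact: jl].
reflexivity.
Qed.

(** Near each time [t0] convergence propagates from any earlier time to any
    later one, by [local_dependence] in a chart at [c t0]. *)
Lemma converges_everywhere : 0 <= a ->
  converges_at (chart_at (c 0)) 0 ->
  forall t, 0 <= t <= a -> converges_at (chart_at (c t)) t.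
Proof.
move=> a0 c0.
have local t0 : exists2 e : R, 0 < e & forall s t, t0 - e < s -> s <= t ->
    t < t0 + e -> 0 <= s -> t <= a ->
    converges_at (chart_at (c s)) s -> converges_at (chart_at (c t)) t.
  have ic := chart_at_dom (c t0); set i := chart_at (c t0) in ic.
  have [e [r [e0 r0 ec loc]]] := local_dependence ic.
  exists e; first exact: e0.
  move=> s t es st te s0 ta cs.
  have sa : 0 <= s <= a by rewrite s0 (le_trans st).
  have ta' : 0 <= t <= a by rewrite ta (le_trans s0).
  have is_ : dom i (c s) by apply: ec; rewrite es (le_lt_trans st).
  have it : dom i (c t) by apply: ec; rewrite te (lt_le_trans es).
  have [di sc] := converges_at_chart sa (chart_at_dom _) is_ cs.
  apply: (converges_at_chart ta' it (chart_at_dom _)).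
  have near1 : \forall l \near F, `|state i (h l) s - state i c s| < r.
    by under eq_near do rewrite distrC; exact: cvgr_dist_lt.
  have near2 : \forall l \near F, dom i (h l t) /\
      `|state i (h l) t - state i c t| <= 2 * `|state i (h l) s - state i c s|.
    apply: (@filterS2 _ F _ _ _ _ _ di near1) => l il rl.
    apply: (loc (J l) (h l) s t (h_geo l) _ es st te il rl).
    by move=> u /andP[su ut]; apply: h_sub; rewrite (le_trans s0)//= (le_trans ut).
  split; first by apply: (@filterS _ F _ _ _ _ near2) => l [].
  apply/cvgrPdist_le => eps eps0.
  have near3 : \forall l \near F, `|state i c s - state i (h l) s| <= eps / 2.
    by apply: cvgr_dist_le => //; rewrite divr_gt0.
  apply: (@filterS2 _ F _ _ _ _ _ near2 near3) => l [_ l2] l3.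
  by rewrite distrC; apply: halved l2 _; rewrite distrC.
apply: real_induction; first exact: c0.
- move=> x /andP[x0 xa] Px; have [e e0 eP] := local x.
  exists e; first exact: e0.
  move=> t /andP[xt tx] ta; apply: (eP x t _ _ tx x0 ta).
  + by rewrite ltrBlDr ltrDl.
  + exact: ltW.
  + by apply: Px; rewrite x0 lexx.
- move=> x /andP[x0 xa] Px; have [e e0 eP] := local x.
  pose s := Num.max 0 (x - e / 2).
  have sx : s < x by rewrite gt_max x0/= ltrBlDr ltrDl divr_gt0.
  apply: (eP s x _ _ _ _ xa).
  + rewrite lt_max; apply/orP; right.
    by rewrite ltrD2l ltrN2 ltr_pdivrMr// ltr_pMr// ltr1n.
  + exact: ltW.
  + by rewrite ltrDl.
  + by rewrite le_max lexx.
  + by apply: Px; rewrite sx le_max lexx.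
Qed.

End Dependence.

(** * Limits of minimizing geodesics *)

Lemma continuous_mulr (R : realType) (T : topologicalType) (f k : T -> R) (x : T) :
  {for x, continuous f} -> {for x, continuous k} ->
  {for x, continuous (fun t => f t * k t)}.
Proof. by move=> fx kx; exact: (@cvgM _ _ (nbhs x)). Qed.

Section Bilin2.
Context (R : realType) (n : nat) (A : 'M[R]_n).

Lemma bilinC : A^T = A -> forall u v, bilin A u v = bilin A v u.
Proof.
move=> sA u v; rewrite /bilin -[LHS]/(_ 0 0) -[u *m A *m v^T]trmxK mxE.
by rewrite !trmx_mul trmxK sA mulmxA.
Qed.

Lemma bilin_diag_continuous : continuous (fun u => bilin A u u).
Proof.
move=> u; under eq_fun do rewrite bilinE.
apply: continuous_sumr => a; apply: continuous_sumr => b.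
apply: continuous_mulr; last exact: cst_continuous.
by apply: continuous_mulr; exact: coord_continuous.
Qed.

(** A coordinate is the product with a fixed vector [w], so that it is bounded
    on unit vectors by the Cauchy-Schwarz inequality. *)
Lemma unit_vectors_compact : A^T = A ->
  (forall v : 'rV[R]_n, v != 0 -> 0 < bilin A v v) ->
  compact [set v : 'rV[R]_n | bilin A v v = 1].
Proof.
move=> sA pos; have uA := pos_unitmx pos.
have pos0 v : 0 <= bilin A v v.
  by have [->|/pos/ltW//] := eqVneq v 0; rewrite bilin0l.
pose w i : 'rV[R]_n := delta_mx 0 i *m invmx A.
have coordE (v : 'rV[R]_n) (i : 'I_n) : v 0 i = bilin A v (w i).
  rewrite bilinC// /bilin mulmxKV// mxE (bigD1 i)//= big1 ?addr0.
    by rewrite !mxE !eqxx mul1r.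
  by move=> j ji; rewrite !mxE (negbTE ji) andbF mul0r.
apply: bounded_closed_compact; last first.
  apply: (@preimage_closed _ _ (fun v => bilin A v v) [set 1]).
    by move=> v _; exact: bilin_diag_continuous.
  exact: closed_eq.
exists (1 + \sum_i bilin A (w i) (w i)); split; first exact: num_real.
move=> K ltK v /= v1; apply: ltW; apply: le_lt_trans ltK.
have s0 : 0 <= \sum_i bilin A (w i) (w i) by apply: sumr_ge0.
apply: norm_row_le => [|i]; first by rewrite addr_ge0.
have : bilin A (w i) (w i) <= \sum_i bilin A (w i) (w i).
  by rewrite (bigD1 i)//= lerDl sumr_ge0.
have := pos0 (w i + (- bilin A v (w i)) *: v).
rewrite !(bilinDl, bilinDr, bilinZl, bilinZr) v1 (bilinC sA (w i) v) -(coordE v i).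
move: (v 0 i) (bilin A (w i) (w i)) (\sum_j _) => b q s CS qs.
have b2 : b * b <= s by nra.
have := sqr_ge0 (b - 2^-1); have := sqr_ge0 (b + 2^-1); rewrite !expr2 => p m.
by rewrite ler_norml; apply/andP; split; nra.
Qed.

End Bilin2.

Section Limits.
Context (R : realType) (n : nat) (M : manifold R n) (g : metric M).

Lemma derive1_velocity (f : R -> M) (t : R) p :
  f t = p -> derive1 (phi (chart_at p) \o f) t = velocity f t.
Proof. by move=> <-; rewrite derive1E. Qed.

(** Completeness gives the geodesic [c] with initial velocity [v]. Its endpoint,
    its speed and its length are the limits of those of the [h l], which are
    constant; a curve of unit speed on the same interval has the same length. *)
Lemma min_geodesic_limit (x y : M) (I : Type) (F : set_system I)
    {FF : ProperFilter F} (a : R) (h : I -> R -> M) (v : 'rV[R]_n) :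
  complete_metric g ->
  (forall l, min_geodesic g x y a (h l)) ->
  velocity (h l) 0 @[l --> F] --> v ->
  exists c, [/\ min_geodesic g x y a c, velocity (h l) 0 @[l --> F] --> velocity c 0
    & velocity (h l) a @[l --> F] --> velocity c a].
Proof.
move=> gc hg hv.
have [c [c_geo c0 cv]] := gc x v.
have exJ l : {J : set R | geodesic_on g J (h l) /\ forall t, 0 <= t <= a -> J t}.
  apply: cid; have [_ [J oJ [aJ geo]] _ _ _] := hg l; by exists J.
pose J l := sval (exJ l).
have h_geo l : geodesic_on g (J l) (h l) by have [] := svalP (exJ l).
have h_sub l t : 0 <= t <= a -> J l t by have [_] := svalP (exJ l); apply.
have h0 l : h l 0 = x by have [_ _ _ []] := hg l.
have ha l : h l a = y by have [_ _ _ []] := hg l.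
have [l0 _] : exists l, [set: I] l by apply: (@filter_ex _ F); exact: filterT.
have a0 : 0 < a by have [] := hg l0.
have conv0 : converges_at c F h (chart_at (c 0)) 0.
  split; first by apply: (@filterE _ F) => l; rewrite h0 c0; exact: chart_at_dom.
  apply: cvg_row => m; rewrite -[m]splitK; case: (fintype.split m) => k /=.
    rewrite state_lshift; under eq_cvg do rewrite state_lshift h0.
    by rewrite c0; exact: cvg_cst.
  rewrite state_rshift (derive1_velocity (erefl (c 0))).
  under eq_cvg do rewrite state_rshift c0 (derive1_velocity (h0 _)).
  by rewrite cv; exact: cvg_row_coord.
have conv t : 0 <= t <= a -> converges_at c F h (chart_at (c t)) t.
  exact: (converges_everywhere (FF := FF) c_geo h_geo h_sub (ltW a0) conv0).
have aa : 0 <= a <= a by rewrite lexx ltW.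
have ca : c a = y.
  have := converges_at_cvg (FF := FF) (chart_at_dom _) (conv a aa).
  under eq_cvg do rewrite ha.
  move=> yc; have := @cvg_unique _ (@pt_hausdorff _ _ M) _ _ _ _ yc
    (@cvg_cst _ _ _ _ _).
  by apply.
have c_speed t : 0 <= t <= a -> speed g c t = 1.
  move=> ta; have [c_smooth _] := c_geo.
  have it := chart_at_dom (c t); set i := chart_at (c t) in it.
  have ct := conv t ta; rewrite -/i in ct.
  have xc := converges_at_pos (FF := FF) it ct.
  have vc := converges_at_vel (FF := FF) it ct.
  have [di _] := ct.
  pose b (x' v' : 'rV[R]_n) := bilin (local_gram g i x') v' v'.
  have bl : F [set l | Num.sqrt (b (phi i (h l t)) (derive1 (phi i \o h l) t)) = 1].
    apply: (@filterS _ F _ _ _ _ di) => l il /=.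
    have [h_smooth _] := h_geo l; have [_ _ sp _ _] := hg l.
    rewrite -(speedE g h_smooth (h_sub l t ta) il).
    by apply: sp; rewrite in_itv.
  have bc : b (phi i (h l t)) (derive1 (phi i \o h l) t) @[l --> F] -->
      b (phi i (c t)) (derive1 (phi i \o c) t).
    rewrite /b bilinE; under eq_cvg do rewrite bilinE.
    apply: cvg_sumr => d; apply: cvg_sumr => e.
    apply: cvgM; first by apply: cvgM; exact: cvg_row_coord.
    apply: (@continuous_cvg _ _ _ F _ (fun l => phi i (h l t))
      (fun u => local_gram g i u d e) _ _ xc).
    apply: (smooth_continuous (@local_gram_smooth _ _ _ g i d e)).
    by exists (c t).
  rewrite (speedE g c_smooth (Logic.I : setT t) it).
  have sc := @continuous_cvg _ _ _ F (@filter_filter _ F FF) _ _ _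
    (@sqrt_continuous R _) bc.
  have s1 : (Num.sqrt \o fun l => b (phi i (h l t)) (derive1 (phi i \o h l) t))
      @ F --> (1 : R) by exact: cvg_near_cst bl.
  have := cvg_lim (@Rhausdorff R) sc; rewrite (cvg_lim (@Rhausdorff R) s1) => sqrt1.
  exact: (esym (sqrt1 FF)).
exists c; split.
- split=> //.
  + exists setT; first exact: openT.
    by split=> // t _.
  + have [_ _ sp _ <-] := hg l0.
    apply: eq_integral => t; rewrite inE /= => ta.
    by rewrite sp// c_speed//; move: ta; rewrite in_itv.
- by rewrite cv.
- have := converges_at_vel (FF := FF) (chart_at_dom _) (conv a aa).
  rewrite (derive1_velocity (erefl (c a))) ca.
  under eq_cvg do rewrite (derive1_velocity (ha _)).
  exact.
Qed.
End Limits.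

(** * Compactness of the endpoint velocities *)

Lemma fmap_ultra (T S : Type) (f : T -> S) (F : set_system T) :
  UltraFilter F -> UltraFilter (f @ F).
Proof.
move=> FU; have PF : ProperFilter F := ultra_proper.
split; first exact: fmap_proper_filter.
move=> G PG FG; apply/seteqP; split; last exact: FG.
move=> A GA; have [//|FA] := in_ultra_setVsetC (f @^-1` A) FU.
have [z []] : (A `&` ~` A) !=set0.
  by apply: (@filter_ex _ G); apply: filterI GA _; exact: FG.
by [].
Qed.

Section Velocities.
Context (R : realType) (n : nat) (M : manifold R n) (g : metric M).

Definition endpoint_velocities (x y : M) (a : R) : set ('rV[R]_n * 'rV[R]_n) :=
  [set p | exists2 c, min_geodesic g x y a c & p = (velocity c 0, velocity c a)].

Lemma min_geodesic_unit x y a c :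
  min_geodesic g x y a c -> inner g x (velocity c 0) (velocity c 0) = 1.
Proof.
move=> [a0 _ /(_ 0) + [c0 _] _]; rewrite in_itv/= lexx ltW// => /(_ isT).
rewrite /speed c0 => s1.
have i0 : 0 <= inner g x (velocity c 0) (velocity c 0).
  have [->|] := eqVneq (velocity c 0) 0; first by rewrite /inner bilin0l.
  by move/(gram_pos g x)/ltW.
by rewrite -(sqr_sqrtr i0) s1 expr1n.
Qed.

(** An ultrafilter on this set gives one on the compact set of unit tangent
    vectors at [x], through the choice of a geodesic for each pair; its limit
    there determines the limit geodesic. *)
Lemma endpoint_velocities_compact x y a : complete_metric g ->
  compact (endpoint_velocities x y a).
Proof.
move=> gc; rewrite compact_ultra => U UU UK.
have [p0 [c0 hc0 _]] : exists p, endpoint_velocities x y a p.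
  by apply: (@filter_ex _ U).
have exh p : {c : R -> M | min_geodesic g x y a c /\
    (endpoint_velocities x y a p -> p = (velocity c 0, velocity c a))}.
  apply: cid; have [[c hc pc]|nK] := pselect (endpoint_velocities x y a p).
    by exists c.
  by exists c0.
pose h p := sval (exh p).
have hg p : min_geodesic g x y a (h p) by have [] := svalP (exh p).
have hp : U [set p | (velocity (h p) 0, velocity (h p) a) = p].
  by apply: filterS UK => p Kp; exact: esym ((svalP (exh p)).2 Kp).
have unitc : compact [set v : 'rV[R]_n | bilin (gram g x) v v = 1].
  by apply: unit_vectors_compact; [exact: gram_sym|exact: gram_pos].
have [v [_ vU]] : [set v : 'rV[R]_n | bilin (gram g x) v v = 1] `&`
    [set v | (fun p => velocity (h p) 0) @ U --> v] !=set0.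
  move: unitc; rewrite compact_ultra; apply; first exact: fmap_ultra.
  by apply: (@filterE _ U) => p /=; exact: (min_geodesic_unit (hg p)).
have PU : ProperFilter U by exact: ultra_proper.
have [c [hc v0 va]] := min_geodesic_limit (FF := PU) gc hg vU.
exists (velocity c 0, velocity c a); split; first by exists c.
have pc : (velocity (h p) 0, velocity (h p) a) @[p --> U] -->
    (velocity c 0, velocity c a).
  exact: cvg_pair v0 va.
have idU : (fun p => p) @ U --> (velocity c 0, velocity c a).
  by apply: cvg_trans pc; apply: near_eq_cvg; exact: hp.
exact: idU.
Qed.

End Velocities.

Section OneSided.
Context (R : realType).

(** Curves are only relevant on [0, a], but their velocities at the endpoints
    are two-sided derivatives. These are determined by the values on one side
    since the curves extend smoothly. *)
Lemma derive_eq_right (V : normedModType R) (f h : R -> V) (t e : R) : 0 < e ->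
  derivable f t 1 -> derivable h t 1 ->
  (forall u, t <= u <= t + e -> f u = h u) -> 'D_1 f t = 'D_1 h t.
Proof.
move=> e0 df dh fh; apply/eqP; rewrite -subr_eq0 -deriveB//; apply/eqP.
have dB := derivableB df dh.
rewrite /derive cvg_at_rightE//; apply: (@cvg_lim _ (@norm_hausdorff _ _)).
apply: cvg_near_cst; near=> u.
have u0 : 0 < u by near: u; exact: nbhs_right_gt.
have ue : u < e by near: u; exact: nbhs_right_lt.
rewrite /= !fctE [u *: 1]mulr1 !fh ?subrr ?scaler0//.
  by rewrite lexx lerDl ltW.
by rewrite lerDr ltW//= addrC lerD2l ltW.
Unshelve. all: by end_near. Qed.

Lemma derive_eq_left (V : normedModType R) (f h : R -> V) (t e : R) : 0 < e ->
  derivable f t 1 -> derivable h t 1 ->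
  (forall u, t - e <= u <= t -> f u = h u) -> 'D_1 f t = 'D_1 h t.
Proof.
move=> e0 df dh fh; apply/eqP; rewrite -subr_eq0 -deriveB//; apply/eqP.
have dB := derivableB df dh.
rewrite /derive cvg_at_leftE//; apply: (@cvg_lim _ (@norm_hausdorff _ _)).
apply: cvg_near_cst; near=> u.
have u0 : u < 0 by near: u; exact: nbhs_left_lt.
have ue : - e < u by near: u; apply: nbhs_left_gt; rewrite oppr_lt0.
rewrite /= !fctE [u *: 1]mulr1 !fh ?subrr ?scaler0//.
  by rewrite lexx gerBl ltW.
by rewrite gerDr (ltW u0) andbT [u + t]addrC lerD2l ltW.
Unshelve. all: by end_near. Qed.

Context (n : nat) (M : manifold R n) (g : metric M).

Lemma min_geodesic_eq_nu (x y : M) (a : R) (c c' : R -> M) :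
  min_geodesic g x y a c -> min_geodesic g x y a c' ->
  (forall t, t \in `[0, a] -> c t = c' t) -> nu a c = nu a c'.
Proof.
move=> [a0 [J _ [aJ [sc _]]] _ [c0 ca] _] [_ [J' _ [aJ' [sc' _]]] _ [c0' ca'] _] cc'.
have I0 : `[0, a]%classic 0 by rewrite /= in_itv/= lexx ltW.
have Ia : `[0, a]%classic a by rewrite /= in_itv/= lexx ltW.
have der (f : R -> M) K p t : smooth_map K f -> K t -> f t = p ->
    derivable (phi (chart_at p) \o f) t 1.
  move=> sf Kt ft; apply/derivable1_diffP; apply: (smooth_map_differentiable sf Kt).
  by rewrite ft; exact: chart_at_dom.
rewrite /nu /velocity /tangent_map c0 ca c0' ca'.
congr (- _, _).
- apply: (derive_eq_right a0).
  + exact: (der _ _ _ _ sc (aJ _ I0) c0).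
  + exact: (der _ _ _ _ sc' (aJ' _ I0) c0').
  + by move=> u ua /=; rewrite cc'// in_itv/=; rewrite add0r in ua.
- apply: (derive_eq_left a0).
  + exact: (der _ _ _ _ sc (aJ _ Ia) ca).
  + exact: (der _ _ _ _ sc' (aJ' _ Ia) ca').
  + by move=> u ua /=; rewrite cc'// in_itv/=; rewrite subrr in ua.
Qed.

Lemma min_geodesic_length (x y : M) (a : R) (c : R -> M) :
  min_geodesic g x y a c -> dist g x y = a%:E.
Proof.
move=> [a0 _ sp _ <-]; rewrite /arc_length.
rewrite (eq_integral (cst 1%E)); last first.
  by move=> t; rewrite inE/= => ta; rewrite sp.
rewrite integral_cst//= lebesgue_measure_itv/= lte_fin a0 oppr0 adde0 mul1e//.
Qed.

End OneSided.

(** * Tangent spaces of the sphere and the stationarity condition *)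

Section TangentSpace.
Context (R : realType) (n : nat) (M : manifold R n) (g : metric M).
Context (Sigma : embedded_sphere M).

(** The tangent space is the image, under the injective differential of the
    embedding at [u], of the orthogonal complement of [u] in the space of
    dimension 3. This is where the dimension 2 of the sphere enters. *)
Lemma tangent_basis (p : M) : sph Sigma p ->
  exists (d : nat) (A : 'M[R]_(d, n)), [/\ (d <= 2)%N,
    forall q : 'rV_d, q *m A = 0 -> q = 0
    & forall v, tangent_space Sigma p v <-> exists q, v = q *m A].
Proof.
move=> [u Su fu]; set f := sph_map Sigma in fu.
have [[U oU [SU sf]] imm inj _] := sph_embedding Sigma.
pose J := jacobian (phi (chart_at (f u)) \o f) u.
have dJ w : tangent_map f u w = w *m J.
  apply: deriveEjacobian; apply: (smooth_map_differentiable sf (SU _ Su)).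
  exact: chart_at_dom.
pose K := kermx u^T.
have orthE (w : 'rV_3) : ((u *m w^T) 0 0 = 0) <-> (w <= K)%MS.
  have -> : (u *m w^T) 0 0 = (w *m u^T) 0 0.
    by rewrite -[u *m w^T]trmxK mxE trmx_mul trmxK.
  split=> [wu|/sub_kermxP ->]; last by rewrite mxE.
  by apply/sub_kermxP/matrixP => i j; rewrite !ord1 wu mxE.
have tangentE v : tangent_space Sigma p v <->
    exists2 w : 'rV_3, (w <= K)%MS & v = w *m J.
  split=> [[u' [w [Su' fu' uw ->]]]|[w /orthE uw ->]].
  - have uu : u' = u by apply: inj => //; rewrite fu'.
    by exists w; [apply/orthE; rewrite -uu|rewrite uu dJ].
  - by exists u, w; split=> //; rewrite dJ.
exists (\rank K), (row_base K *m J); split.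
- rewrite mxrank_ker mxrank_tr leq_subLR addn2 !ltnS.
  rewrite lt0n mxrank_eq0; apply: contraPneq Su => ->.
  by rewrite /unit_sphere /= mul0mx mxE => /esym/eqP; rewrite oner_eq0.
- move=> q; rewrite mulmxA => qJ.
  have qK : (q *m row_base K <= K)%MS.
    by rewrite (submx_trans (submxMl _ _))// eq_row_base.
  have : q *m row_base K = 0.
    by apply: (imm u _ Su ((orthE _).2 qK)); rewrite -/f dJ.
  move=> qK0; apply: (row_free_inj (row_base_free K)); by rewrite qK0 mul0mx.
- move=> v; rewrite tangentE; split=> [[w wK ->]|[q ->]].
    have /submxP[q ->] : (w <= row_base K)%MS by rewrite eq_row_base.
    by exists q; exact: esym (mulmxA _ _ _).
  exists (q *m row_base K); last exact: mulmxA.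
  by rewrite (submx_trans (submxMl _ _))// eq_row_base.
Qed.

(** The orthogonal projection is given by the normal equations: [A G A^T] is
    the Gram matrix of the rows of [A]. *)
Lemma tangent_projP (p : M) v : sph Sigma p ->
  tangent_space Sigma p (tangent_proj g Sigma p v) /\
  forall z, tangent_space Sigma p z ->
    inner g p (v - tangent_proj g Sigma p v) z = 0.
Proof.
move=> Sp; have [d [A [_ Afree TA]]] := tangent_basis Sp.
pose G := gram g p; pose B := A *m G *m A^T.
have uB : B \in unitmx.
  apply: pos_unitmx => q q0.
  have -> : bilin B q q = bilin G (q *m A) (q *m A).
    by rewrite /bilin /B trmx_mul !mulmxA.
  by apply: gram_pos; apply: contra_neq q0; exact: Afree.
apply: (@xgetPex _ 0 [set w | tangent_space Sigma p w /\
  forall z, tangent_space Sigma p z -> inner g p (v - w) z = 0]).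
exists (v *m G *m A^T *m invmx B *m A); split.
  by apply/TA; exists (v *m G *m A^T *m invmx B).
move=> z /TA[q ->]; rewrite /inner /bilin -/G trmx_mul !mulmxBl !mulmxA.
rewrite -[_ *m A *m G]mulmxA -[_ *m (A *m G) *m A^T]mulmxA -/B mulmxKV//.
by rewrite subrr mxE.
Qed.

Lemma tangent_comb (p : M) k (c : 'I_k -> R) (v : 'I_k -> 'rV[R]_n) :
  sph Sigma p -> (forall i, tangent_space Sigma p (v i)) ->
  tangent_space Sigma p (\sum_i c i *: v i).
Proof.
move=> Sp vT; have [d [A [_ _ TA]]] := tangent_basis Sp.
have /(_ _)/cid-/all_sig[q vq] : forall i, exists q, v i = q *m A.
  by move=> i; exact/TA.
apply/TA; exists (\sum_i c i *: q i); rewrite mulmx_suml.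
by apply: eq_bigr => i _; rewrite vq scalemxAl.
Qed.

(** A tangent vector vanishes when it is orthogonal to the tangent space. *)
Lemma sum_tangent_proj_eq0 (p : M) k (c : 'I_k -> R) (v : 'I_k -> 'rV[R]_n) :
  sph Sigma p ->
  \sum_i c i *: tangent_proj g Sigma p (v i) = 0 <->
  forall z, tangent_space Sigma p z -> \sum_i c i * inner g p (v i) z = 0.
Proof.
move=> Sp.
have E z : tangent_space Sigma p z -> \sum_i c i * inner g p (v i) z =
    inner g p (\sum_i c i *: tangent_proj g Sigma p (v i)) z.
  move=> Tz; rewrite /inner bilin_suml; apply: eq_bigr => i _.
  rewrite bilinZl; congr (_ * _).
  have [_ /(_ z Tz)] := tangent_projP (v i) Sp.
  rewrite /inner -scaleN1r bilinDl bilinZl mulN1r => /eqP.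
  by rewrite subr_eq0 => /eqP.
split=> [s0 z Tz|vz]; first by rewrite E// s0 /inner bilin0l.
have Ts : tangent_space Sigma p (\sum_i c i *: tangent_proj g Sigma p (v i)).
  by apply: tangent_comb => // i; have [] := tangent_projP (v i) Sp.
apply/eqP; rewrite -[_ == 0]negbK; apply/negP => /(gram_pos g p).
by rewrite -/(inner g p _ _) -E// vz// ltxx.
Qed.

End TangentSpace.

Section Final.
Context (R : realType) (n : nat) (M : manifold R n) (g : metric M).
Context (Sigma : embedded_sphere M) (x y : M).
Context (Sx : sph Sigma x) (Sy : sph Sigma y).

(** Projections are eliminated: stationarity only involves the pairing of the
    outward vectors with tangent vectors. *)
Lemma sum_nuT_eq0 a k (c : 'I_k -> R) (h : 'I_k -> R -> M) :
  \sum_i c i *: nuT g Sigma x y a (h i) = 0 <->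
  forall w, tangent_space Sigma x w.1 -> tangent_space Sigma y w.2 ->
    \sum_i c i * inner2 g x y w (nu a (h i)) = 0.
Proof.
have -> : \sum_i c i *: nuT g Sigma x y a (h i) =
    (\sum_i c i *: tangent_proj g Sigma x (nu a (h i)).1,
     \sum_i c i *: tangent_proj g Sigma y (nu a (h i)).2).
  rewrite [LHS]surjective_pairing; congr pair.
    exact: (big_morph fst (fun _ _ => erefl) erefl).
  exact: (big_morph snd (fun _ _ => erefl) erefl).
have split2 w : \sum_i c i * inner2 g x y w (nu a (h i)) =
    \sum_i c i * inner g x (nu a (h i)).1 w.1 +
    \sum_i c i * inner g y (nu a (h i)).2 w.2.
  rewrite -big_split; apply: eq_bigr => i _ /=; rewrite /inner2 mulrDr.
  by congr (_ * _ + _ * _); apply: bilinC; exact: gram_sym.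
have T0 p : sph Sigma p -> tangent_space Sigma p 0.
  move=> Sp; have := @tangent_comb R n M Sigma p 0 (fun=> 0) (fun=> 0) Sp.
  by rewrite big_ord0; apply; case.
split=> [[/(sum_tangent_proj_eq0 _ _ _ Sx) s1 /(sum_tangent_proj_eq0 _ _ _ Sy) s2]|s].
  by move=> w w1 w2; rewrite split2 s1// s2// addr0.
congr pair.
- apply/(sum_tangent_proj_eq0 _ _ _ Sx) => z Tz.
  have := s (z, 0) Tz (T0 y Sy); rewrite split2 /= [X in _ + X]big1 ?addr0//.
  by move=> i _; rewrite /inner bilin0r mulr0.
- apply/(sum_tangent_proj_eq0 _ _ _ Sy) => z Tz.
  have := s (0, z) (T0 x Sx) Tz; rewrite split2 /= [X in X + _]big1 ?add0r//.
  by move=> i _; rewrite /inner bilin0r mulr0.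
Qed.

(** A weighted mean of negative numbers is negative. *)
Lemma stationary_critical k a (h : 'I_k -> R -> M) :
  simultaneously_stationary g Sigma x y a h -> critical_point g Sigma x y.
Proof.
move=> [hg _ [c [c01 c1 /sum_nuT_eq0 s0]]] [w [w1 w2 wneg]].
have := s0 w w1 w2; apply/eqP; rewrite lt_eqF//.
have neg i : c i * inner2 g x y w (nu a (h i)) < 0.
  by have /andP[ci _] := c01 i; rewrite pmulr_rlt0// wneg.
case: k h hg c c01 c1 neg {s0} => [|k] h hg c c01 c1 neg.
  by move: c1; rewrite big_ord0 => /esym/eqP; rewrite oner_eq0.
rewrite big_ord_recl ltr_wnDr//.
by apply: sumr_le0 => i _; exact: ltW.
Qed.

(** The pairing with tangent vectors is written in coordinates with respect to
    bases of the two tangent spaces, where [convex_alternative] applies to the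
    compact set of coordinate vectors [xi (nu a c)]. *)
Lemma critical_stationary : complete_metric g -> critical_point g Sigma x y ->
  exists (k : nat) (a : R) (h : 'I_k -> R -> M),
     (k <= 5)%N /\ simultaneously_stationary g Sigma x y a h.
Proof.
move=> gc crit.
have [d1 [A [d12 _ TA]]] := tangent_basis Sx.
have [d2 [B [d22 _ TB]]] := tangent_basis Sy.
(* coordinates of the tangential part of a pair of vectors *)
pose xi (v : 'rV[R]_n * 'rV[R]_n) : 'rV[R]_(d1 + d2) :=
  row_mx (v.1 *m (gram g x *m A^T)) (v.2 *m (gram g y *m B^T)).
have xiE q1 q2 v : inner2 g x y (q1 *m A, q2 *m B) v = (row_mx q1 q2 *m (xi v)^T) 0 0.
  rewrite /inner2 /inner /bilin /xi tr_row_mx mul_row_col [RHS]mxE /=.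
  by rewrite !trmx_mul !trmxK !gram_sym !mulmxA.
(* criticality in coordinates: no open half-space contains all the [xi] *)
have neg_xi (w : 'rV[R]_(d1 + d2)) : ~ (forall a c, min_geodesic g x y a c ->
    (w *m (xi (nu a c))^T) 0 0 < 0).
  move=> wneg; apply: crit; exists (lsubmx w *m A, rsubmx w *m B); split.
  - by apply/TA; exists (lsubmx w).
  - by apply/TB; exists (rsubmx w).
  - by move=> a c hc; rewrite xiE hsubmxK; exact: wneg.
have [a [c0 hc0]] : exists a c, min_geodesic g x y a c.
  apply: contrapT => none; apply: (neg_xi 0) => a c hc.
  by case: none; exists a, c.
have same a' c : min_geodesic g x y a' c -> a' = a.
  by move=> /min_geodesic_length; rewrite (min_geodesic_length hc0) => -[].
pose E := endpoint_velocities g x y a.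
(* [nu] in terms of the pair of endpoint velocities *)
pose xi' (p : 'rV[R]_n * 'rV[R]_n) := xi (- p.1, p.2).
have xi'_cont : continuous xi'.
  have lin m (X : 'M[R]_(n, m)) : continuous (fun v : 'rV[R]_n => v *m X).
    move=> v; apply: (@cvg_row _ _ _ (nbhs v)) => j.
    rewrite mxE; under eq_cvg do rewrite mxE.
    apply: (@cvg_sumr _ _ _ (nbhs v)) => i.
    apply: (@cvgM _ _ (nbhs v)); last exact: cvg_cst.
    exact: coord_continuous.
  move=> p; apply: (@cvg_row _ _ _ (nbhs p)) => m.
  rewrite -[m]splitK; case: (fintype.split m) => j /=.
    rewrite /xi' /xi row_mxEl; under eq_cvg do rewrite row_mxEl.
    apply: (@cvg_row_coord _ _ _ (nbhs p)).
    apply: (@continuous_cvg _ _ _ (nbhs p) _ (fun p => - p.1) _ _ (lin _ _ _)).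
    by apply: cvgN; exact: cvg_fst.
  rewrite /xi' /xi row_mxEr; under eq_cvg do rewrite row_mxEr.
  apply: (@cvg_row_coord _ _ _ (nbhs p)).
  apply: (@continuous_cvg _ _ _ (nbhs p) _ (fun p => p.2) _ _ (lin _ _ _)).
  exact: cvg_snd.
have Kc : compact (xi' @` E).
  apply: continuous_compact; last exact: endpoint_velocities_compact.
  by apply: continuous_subspaceT => p; exact: xi'_cont.
have K0 : (xi' @` E) !=set0.
  pose p0 := (velocity c0 0, velocity c0 a).
  by exists (xi' p0); exists p0 => //; exists c0.
have Kw (w : 'rV[R]_(d1 + d2)) : exists2 v, (xi' @` E) v & 0 <= (w *m v^T) 0 0.
  apply: contrapT => none; apply: (neg_xi w) => a' c hc.
  have aa := same _ _ hc; rewrite aa in hc *.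
  rewrite ltNge; apply/negP => pos; apply: none.
  exists (xi (nu a c)) => //.
  by exists (velocity c 0, velocity c a) => //; exists c.
have [k [X [c [kd [Xinj XK] cpos c1 cX]]]] := convex_alternative Kc K0 Kw.
have /(_ _)/cid-/all_sig[h hP] : forall i, exists h,
    min_geodesic g x y a h /\ X i = xi (nu a h).
  by move=> i; have [_ [h hg ->] <-] := XK i; exists h.
exists k, a, h; split.
  by apply: leq_trans kd _; rewrite ltnS; exact: leq_add d12 d22.
split.
- by move=> i; have [] := hP i.
- move=> i j ij; apply: contrapT => neq; move/eqP: ij; apply; apply: Xinj.
  have [hi ->] := hP i; have [hj ->] := hP j.
  rewrite (min_geodesic_eq_nu hi hj)// => t ta; apply: contrapT => ht.
  by apply: neq; exists t.
exists c; split=> //.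
- move=> i; rewrite cpos /= -c1 (bigD1 i)//= lerDl sumr_ge0// => j _.
  exact: ltW.
- apply/sum_nuT_eq0 => -[w1 w2] /= /TA[q1 ->] /TB[q2 ->].
  under eq_bigr do rewrite xiE.
  transitivity ((row_mx q1 q2 *m (\sum_i c i *: X i)^T) 0 0); last first.
    by rewrite cX linear0 mulmx0 mxE.
  rewrite linear_sum mulmx_sumr summxE; apply: eq_bigr => i _.
  by have [_ ->] := hP i; rewrite linearZ -scalemxAr [RHS]mxE.
Qed.

End Final.

Theorem proposition1p6 (R : realType) (n : nat) (M : manifold R n)
    (g : metric M) (g_complete : complete_metric g)
    (Sigma : embedded_sphere M) (x y : M)
    (xy_in : pairs Sigma [set x; y]) :
  ((exists (k : nat) (a : R) (gamma : 'I_k -> R -> M),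
      simultaneously_stationary g Sigma x y a gamma) ->
   critical_point g Sigma x y) /\
  (critical_point g Sigma x y ->
   exists (k : nat) (a : R) (gamma : 'I_k -> R -> M),
     (k <= 5)%N /\ simultaneously_stationary g Sigma x y a gamma).
Proof.
have [p [q [Sp Sq pq]]] := xy_in.
have in_sph z : [set x; y] z -> sph Sigma z by rewrite pq => -[->|->].
have Sx : sph Sigma x by apply: in_sph; left.
have Sy : sph Sigma y by apply: in_sph; right.
split; last exact: critical_stationary.
by move=> [k [a [h]]]; exact: stationary_critical.
Qed.
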